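(* The following are equivalent over $\mathsf{RCA}_0$: (i) The infinite pigeonhole principle $\mathsf{IPP}$. (ii) Any finite set of reals is bounded. (iii) Any non-empty finite set of reals has a maximum.
   Context: $\mathsf{RCA}_0$ is the usual base system of second-order arithmetic (basic arithmetic axioms, $\Sigma^0_1$-induction, $\Delta^0_1$-comprehension). ''Equivalent over $\mathsf{RCA}_0$'' means that the equivalences, formalized in second-order arithmetic, are provable in $\mathsf{RCA}_0$. Reals. A real is a Cauchy sequence $x=(x_n)_{n\in\mathbb N}$ of rationals with no rate of convergence given: for each rational $\varepsilon>0$ there is an $N\in\mathbb N$ with $|x_m-x_n|<\varepsilon$ for all $m,n\geq N$. For reals $x,y$: $x\leq y$ means that for each rational $\varepsilon>0$ there is an $N$ with $x_n\leq y_n+\varepsilon$ for all $n\geq N$; $x=y$ means $x\leq y$ and $y\leq x$. A finite set of reals is given as a finite family $(x_n)_{n<N}$ with $N\in\mathbb N$, i.e., a family of rationals $(x_{ni})_{n<N,i\in\mathbb N}$ (coded as one set) such that $x_n=(x_{ni})_{i\in\mathbb N}$ is a real for each $n<N$; no uniformity in $n$ is required. $\mathsf{IPP}$ (infinite pigeonhole principle): for any $N\in\mathbb N$ and any $c\colon\mathbb N\to\{0,\ldots,N\}$ there is an $n\leq N$ such that $\{i\in\mathbb N:c(i)=n\}$ is infinite. *)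

(* Defs.v *)
(** Second-order arithmetic as a two-sorted first-order language with a
    classical proof calculus, the system RCA_0 in it (axioms as in Simpson,
    "Subsystems of Second Order Arithmetic"), and the L_2-sentences compared
    in the main theorem. *)

From Stdlib Require Import List.
Import ListNotations.

(** * Syntax of L_2

    De Bruijn indices, with separate index spaces for number variables and
    set variables: [All] binds number variable 0, [AllSet] binds set variable 0.
    Set terms are just set variables. *)

Inductive term : Type :=
| Var (n : nat)
| Zero
| One
| Plus (s t : term)
| Times (s t : term).

Inductive form : Type :=
| Eq (s t : term)
| Lt (s t : term)
| Mem (t : term) (X : nat)
| Bot
| Imp (p q : form)
| All (p : form)
| AllSet (p : form).

Definition Neg (p : form) : form := Imp p Bot.
Definition And (p q : form) : form := Neg (Imp p (Neg q)).
Definition Or (p q : form) : form := Imp (Neg p) q.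
Definition Iff (p q : form) : form := And (Imp p q) (Imp q p).
Definition Ex (p : form) : form := Neg (All (Neg p)).
Definition ExSet (p : form) : form := Neg (AllSet (Neg p)).

Definition scons {A : Type} (a : A) (f : nat -> A) (n : nat) : A :=
  match n with 0 => a | S m => f m end.

Fixpoint tsubst (s : nat -> term) (t : term) : term :=
  match t with
  | Var n => s n
  | Zero => Zero
  | One => One
  | Plus a b => Plus (tsubst s a) (tsubst s b)
  | Times a b => Times (tsubst s a) (tsubst s b)
  end.

Definition tshift : term -> term := tsubst (fun n => Var (S n)).

Definition up (s : nat -> term) : nat -> term :=
  scons (Var 0) (fun n => tshift (s n)).

Definition upS (r : nat -> nat) : nat -> nat :=
  scons 0 (fun n => S (r n)).

(** Simultaneous substitution [s] of terms for number variables and renaming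
    [r] of set variables. *)
Fixpoint subst (s : nat -> term) (r : nat -> nat) (p : form) : form :=
  match p with
  | Eq a b => Eq (tsubst s a) (tsubst s b)
  | Lt a b => Lt (tsubst s a) (tsubst s b)
  | Mem a X => Mem (tsubst s a) (r X)
  | Bot => Bot
  | Imp p q => Imp (subst s r p) (subst s r q)
  | All p => All (subst (up s) r p)
  | AllSet p => AllSet (subst s (upS r) p)
  end.

Definition shift : form -> form := subst (fun n => Var (S n)) (fun X => X).
Definition shiftS : form -> form := subst Var S.
Definition inst (t : term) : form -> form := subst (scons t Var) (fun X => X).
Definition instS (X : nat) : form -> form := subst Var (scons X (fun Y => Y)).

(** * Provability

    Classical natural deduction with equality for two-sorted logic.  Free
    variables of an axiom are read universally: the rules introducing
    quantifiers shift the hypotheses [G] only, so every generalization of an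
    axiom is provable. *)

Inductive prv (Ax : form -> Prop) : list form -> form -> Prop :=
| prv_axiom G p : Ax p -> prv Ax G p
| prv_hyp G p : In p G -> prv Ax G p
| prv_impI G p q : prv Ax (p :: G) q -> prv Ax G (Imp p q)
| prv_impE G p q : prv Ax G (Imp p q) -> prv Ax G p -> prv Ax G q
| prv_dne G p : prv Ax G (Neg (Neg p)) -> prv Ax G p
| prv_allI G p : prv Ax (map shift G) p -> prv Ax G (All p)
| prv_allE G p t : prv Ax G (All p) -> prv Ax G (inst t p)
| prv_allSI G p : prv Ax (map shiftS G) p -> prv Ax G (AllSet p)
| prv_allSE G p X : prv Ax G (AllSet p) -> prv Ax G (instS X p)
| prv_eqI G t : prv Ax G (Eq t t)
| prv_eqE G p s t : prv Ax G (Eq s t) -> prv Ax G (inst s p) -> prv Ax G (inst t p).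

(** * Writing formulas with named variables

    An [fm] is a formula that still has to be told how many number and set
    quantifiers it stands under; a bound variable is represented by the depth
    at which it was introduced and turned into an index where it occurs.  A
    sentence is obtained by placing an [fm] at depth 0 (see [sent]). *)

Definition tm : Type := nat -> term.
Definition st : Type := nat -> nat.
Definition fm : Type := nat -> nat -> form.

Definition tzero : tm := fun _ => Zero.
Definition tone : tm := fun _ => One.
Definition tadd (s t : tm) : tm := fun d => Plus (s d) (t d).
Definition tmul (s t : tm) : tm := fun d => Times (s d) (t d).

Definition feq (s t : tm) : fm := fun d _ => Eq (s d) (t d).
Definition flt (s t : tm) : fm := fun d _ => Lt (s d) (t d).
Definition fmem (t : tm) (X : st) : fm := fun d e => Mem (t d) (X e).
Definition ftop : fm := fun _ _ => Neg Bot.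
Definition fneg (p : fm) : fm := fun d e => Neg (p d e).
Definition fimp (p q : fm) : fm := fun d e => Imp (p d e) (q d e).
Definition fand (p q : fm) : fm := fun d e => And (p d e) (q d e).
Definition f_or (p q : fm) : fm := fun d e => Or (p d e) (q d e).
Definition fiff (p q : fm) : fm := fun d e => Iff (p d e) (q d e).

Definition bvar (d : nat) : tm := fun d' => Var (d' - S d).
Definition bvarS (e : nat) : st := fun e' => e' - S e.

Definition fall (P : tm -> fm) : fm := fun d e => All (P (bvar d) (S d) e).
Definition fex (P : tm -> fm) : fm := fun d e => Ex (P (bvar d) (S d) e).
Definition fallS (P : st -> fm) : fm := fun d e => AllSet (P (bvarS e) d (S e)).
Definition fexS (P : st -> fm) : fm := fun d e => ExSet (P (bvarS e) d (S e)).

Definition sent (p : fm) : form := p 0 0.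

Declare Scope tm_scope.
Declare Scope fm_scope.
Delimit Scope tm_scope with tm.
Delimit Scope fm_scope with fm.
Bind Scope tm_scope with tm.
Bind Scope fm_scope with fm.

Notation "0" := tzero : tm_scope.
Notation "1" := tone : tm_scope.
Notation "s + t" := (tadd s t) : tm_scope.
Notation "s * t" := (tmul s t) : tm_scope.

Notation "s ≡ t" := (feq s%tm t%tm) (at level 70, no associativity) : fm_scope.
Notation "s < t" := (flt s%tm t%tm) : fm_scope.
Notation "s <= t" := (f_or (flt s%tm t%tm) (feq s%tm t%tm)) : fm_scope.
Notation "t ∈ X" := (fmem t%tm X) (at level 70, no associativity) : fm_scope.
Notation "~ p" := (fneg p) : fm_scope.
Notation "p /\ q" := (fand p q) : fm_scope.
Notation "p \/ q" := (f_or p q) : fm_scope.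
Notation "p ==> q" := (fimp p q) (at level 99, right associativity) : fm_scope.
Notation "p <-> q" := (fiff p q) : fm_scope.
Notation "'ALL' x .. y , p" := (fall (fun x => .. (fall (fun y => p%fm)) ..))
  (at level 200, x binder, y binder, right associativity) : fm_scope.
Notation "'EX' x .. y , p" := (fex (fun x => .. (fex (fun y => p%fm)) ..))
  (at level 200, x binder, y binder, right associativity) : fm_scope.
Notation "'ALLS' X .. Y , p" := (fallS (fun X => .. (fallS (fun Y => p%fm)) ..))
  (at level 200, X binder, Y binder, right associativity) : fm_scope.
Notation "'EXS' X .. Y , p" := (fexS (fun X => .. (fexS (fun Y => p%fm)) ..))
  (at level 200, X binder, Y binder, right associativity) : fm_scope.

Example named_variables :
  sent (ALL x, EXS X, EX y, x + 1 < y /\ x ∈ X)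
  = All (ExSet (Ex (And (Lt (Plus (Var 1) One) (Var 0)) (Mem (Var 1) 0)))).
Proof. reflexivity. Qed.

(** * The system RCA_0 *)

Definition basic_axioms : list form := map sent
  [ (ALL n, ~ n + 1 ≡ 0)%fm;
    (ALL m n, m + 1 ≡ n + 1 ==> m ≡ n)%fm;
    (ALL m, m + 0 ≡ m)%fm;
    (ALL m n, m + (n + 1) ≡ (m + n) + 1)%fm;
    (ALL m, m * 0 ≡ 0)%fm;
    (ALL m n, m * (n + 1) ≡ m * n + m)%fm;
    (ALL m, ~ m < 0)%fm;
    (ALL m n, m < n + 1 <-> (m < n \/ m ≡ n))%fm ].

(** Bounded quantifier formulas; [tshift t] is a term in which the variable
    bound by the quantifier does not occur. *)
Inductive Sigma00 : form -> Prop :=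
| S00_eq s t : Sigma00 (Eq s t)
| S00_lt s t : Sigma00 (Lt s t)
| S00_mem t X : Sigma00 (Mem t X)
| S00_bot : Sigma00 Bot
| S00_imp p q : Sigma00 p -> Sigma00 q -> Sigma00 (Imp p q)
| S00_ball t p : Sigma00 p -> Sigma00 (All (Imp (Lt (Var 0) (tshift t)) p))
| S00_bex t p : Sigma00 p -> Sigma00 (Ex (And (Lt (Var 0) (tshift t)) p)).

Definition Sigma01 (p : form) : Prop := exists q, Sigma00 q /\ p = Ex q.
Definition Pi01 (p : form) : Prop := exists q, Sigma00 q /\ p = All q.

(** In the two schemes, number variable 0 of [p] and [q] is the distinguished
    variable n; all other variables are parameters. *)
Definition induction (p : form) : form :=
  Imp (And (inst Zero p)
           (All (Imp p (subst (scons (Plus (Var 0) One) (fun n => Var (S n)))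
                              (fun X => X) p))))
      (All p).

Definition comprehension (p q : form) : form :=
  Imp (All (Iff p q)) (ExSet (All (Iff (Mem (Var 0) 0) (shiftS p)))).

Inductive RCA0 : form -> Prop :=
| RCA0_basic p : In p basic_axioms -> RCA0 p
| RCA0_induction p : Sigma01 p -> RCA0 (induction p)
| RCA0_comprehension p q : Sigma01 p -> Pi01 q -> RCA0 (comprehension p q).

(** * Pairs and functions *)

Definition pair (i j : tm) : tm := ((i + j) * (i + j) + i)%tm.

(** [F] is (the graph of) a function from [A] to [B]. *)
Definition IsFun (F : st) (A B : tm -> fm) : fm :=
  ((ALL z, z ∈ F ==> EX a b, A a /\ B b /\ z ≡ pair a b)
   /\ (ALL a, A a ==>
        EX b, pair a b ∈ F /\ ALL b', pair a b' ∈ F ==> b' ≡ b))%fm.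

Definition IsNat (_ : tm) : fm := ftop.

(** * Rationals

    The triple ((a, b), c) with c > 0 stands for (a - b) / c.  As usual, a
    rational is the least code among those with the same value, so that
    equality of rationals is equality of codes. *)

Definition triple (a b c : tm) : tm := pair (pair a b) c.

Definition Frac (q a b c : tm) : fm := (q ≡ triple a b c /\ 0 < c)%fm.

Definition Rat (q : tm) : fm :=
  (EX a b c, Frac q a b c /\
     ALL a' b' c', 0 < c' /\ a * c' + b' * c ≡ a' * c + b * c' ==>
       q <= triple a' b' c')%fm.

Definition RatPos (q : tm) : fm := (EX a b c, Frac q a b c /\ b < a)%fm.

(** p < q + r and p <= q + r, for codes p, q, r of fractions (denominators
    cleared). *)
Definition LtAdd (p q r : tm) : fm :=
  (EX a b c a' b' c' a'' b'' c'',
     Frac p a b c /\ Frac q a' b' c' /\ Frac r a'' b'' c'' /\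
     a * c' * c'' + b' * c * c'' + b'' * c * c'
     < b * c' * c'' + a' * c * c'' + a'' * c * c')%fm.

Definition LeAdd (p q r : tm) : fm :=
  (EX a b c a' b' c' a'' b'' c'',
     Frac p a b c /\ Frac q a' b' c' /\ Frac r a'' b'' c'' /\
     a * c' * c'' + b' * c * c'' + b'' * c * c'
     <= b * c' * c'' + a' * c * c'' + a'' * c * c')%fm.

(** * Reals

    A sequence of rationals is given by the formula [x i q] saying that its
    i-th entry is q.  This covers both a sequence coded by a set and a member
    of a family coded by a set. *)

Definition ratseq : Type := tm -> tm -> fm.

Definition entries (Y : st) : ratseq := fun i q => (pair i q ∈ Y)%fm.
Definition row (X : st) (n : tm) : ratseq := fun i q => (pair (pair n i) q ∈ X)%fm.

Definition Cauchy (x : ratseq) : fm :=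
  (ALL eps, Rat eps /\ RatPos eps ==>
     EX N, ALL m n, N <= m /\ N <= n ==>
       ALL p q, x m p /\ x n q ==> LtAdd p q eps /\ LtAdd q p eps)%fm.

Definition RealLe (x y : ratseq) : fm :=
  (ALL eps, Rat eps /\ RatPos eps ==>
     EX N, ALL n, N <= n ==>
       ALL p q, x n p /\ y n q ==> LeAdd p q eps)%fm.

Definition IsReal (Y : st) : fm := (IsFun Y IsNat Rat /\ Cauchy (entries Y))%fm.

(** [X] codes a family of rationals x_{ni} with n < N and i in the natural
    numbers, each row of which is a real. *)
Definition RealFamily (N : tm) (X : st) : fm :=
  (IsFun X (fun z => EX n i, n < N /\ z ≡ pair n i) Rat
   /\ ALL n, n < N ==> Cauchy (row X n))%fm.

(** * The three statements *)

Definition IPP : form := sent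
  (ALL N, ALLS C, IsFun C IsNat (fun n => n <= N) ==>
     EX n, n <= N /\ ALL k, EX i, k < i /\ pair i n ∈ C)%fm.

Definition FiniteSetsBounded : form := sent
  (ALL N, ALLS X, RealFamily N X ==>
     EXS Y Z, IsReal Y /\ IsReal Z /\
       ALL n, n < N ==>
         RealLe (entries Y) (row X n) /\ RealLe (row X n) (entries Z))%fm.

Definition FiniteSetsHaveMax : form := sent
  (ALL N, ALLS X, 0 < N /\ RealFamily N X ==>
     EX m, m < N /\ ALL n, n < N ==> RealLe (row X n) (row X m))%fm.

(* Main.v *)
(** Provability is reduced to truth in models by the completeness theorem for
    [prv], which is available because the axioms of RCA_0 are closed under
    substitution.  So one can argue inside an arbitrary, possibly nonstandard,
    model of RCA_0.

    IPP gives maxima and minima of a family x_0, ..., x_{N-1}: color i by the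
    first n for which the i-th entry of x_n is largest (smallest) in its column.
    If n is the color of infinitely many i, then for each m infinitely many
    entries of x_m are at most the corresponding entries of x_n, and as reals are
    Cauchy without a modulus, this is enough for x_m <= x_n.

    Conversely, given a coloring, let the i-th entry of x_n be the last index up
    to i of color n.  If all colors were finite, the x_n would be eventually
    constant, hence reals, and a real above all x_n, being Cauchy, would be below
    some natural number, which bounds all indices. *)

Require Import Defs.
From Stdlib Require Import List Arith Lia Classical ClassicalEpsilon Ring.
From Stdlib Require Import FunctionalExtensionality PropExtensionality Cantor.
Import ListNotations.

(** * Substitution *)

(** The obstacle is the weak induction. The number of rows may be nonstandard, and induction is
    available only for a bounded formula preceded by one existential quantifier. Comparing the i-th
    entries of all rows quantifies over entries, for which no bound is given in advance. A bound on
    the whole column makes the comparison a bounded formula, and as any such bound gives the same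
    verdict, the coloring is Delta_1.

    In the converse, finiteness of each color gives a bound on the indices of that color, but no
    bound common to all colors. A real above all rows supplies just this. The rows can be formed
    without knowing the individual bounds, because no modulus of convergence is asked for.

    Definability is treated as a semantic property of predicates with closure rules, so that it can
    be checked mechanically. In the completeness proof the Henkin witnesses are ordinary variables:
    each stage has a finite context, and so leaves variables fresh. *)

Lemma tsubst_ext s s' t :
  (forall n, s n = s' n) -> tsubst s t = tsubst s' t.
Proof. intros H; induction t; simpl; congruence. Qed.

Lemma up_ext s s' : (forall n, s n = s' n) -> forall n, up s n = up s' n.
Proof. intros H [|n]; simpl; [|rewrite H]; reflexivity. Qed.

Lemma upS_ext r r' : (forall n, r n = r' n) -> forall n, upS r n = upS r' n.
Proof. intros H [|n]; simpl; [|rewrite H]; reflexivity. Qed.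

Lemma subst_ext p : forall s s' r r',
  (forall n, s n = s' n) -> (forall n, r n = r' n) -> subst s r p = subst s' r' p.
Proof.
  induction p as [a b|a b|a X| |p IHp q IHq|p IHp|p IHp]; intros s s' r r' Hs Hr; simpl; f_equal;
    auto using tsubst_ext, up_ext, upS_ext.
Qed.

Lemma tsubst_comp s s' t :
  tsubst s' (tsubst s t) = tsubst (fun n => tsubst s' (s n)) t.
Proof. induction t; simpl; congruence. Qed.

Lemma tsubst_Var t : tsubst Var t = t.
Proof. induction t; simpl; congruence. Qed.

Lemma tshift_up s t : tsubst (up s) (tshift t) = tshift (tsubst s t).
Proof. unfold tshift; rewrite !tsubst_comp; reflexivity. Qed.

Lemma subst_comp p : forall s r s' r',
  subst s' r' (subst s r p) = subst (fun n => tsubst s' (s n)) (fun n => r' (r n)) p.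
Proof.
  induction p as [a b|a b|a X| |p IHp q IHq|p IHp|p IHp];
    intros; simpl; rewrite ?tsubst_comp; f_equal; auto.
  - rewrite IHp; apply subst_ext; auto.
    intros [|n]; simpl; auto. apply tshift_up.
  - rewrite IHp; apply subst_ext; auto. intros [|n]; reflexivity.
Qed.

Lemma subst_Var p : subst Var (fun X => X) p = p.
Proof.
  induction p; simpl; rewrite ?tsubst_Var; f_equal; auto.
  - rewrite <- IHp at 2; apply subst_ext; auto. intros [|n]; reflexivity.
  - rewrite <- IHp at 2; apply subst_ext; auto. intros [|n]; reflexivity.
Qed.

Lemma subst_inst s r t p :
  subst s r (inst t p) = inst (tsubst s t) (subst (up s) r p).
Proof.
  unfold inst; rewrite !subst_comp; apply subst_ext; auto.
  intros [|n]; simpl; auto.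
  unfold tshift; rewrite tsubst_comp; simpl; symmetry; apply tsubst_Var.
Qed.

Lemma subst_instS s r X p :
  subst s r (instS X p) = instS (r X) (subst s (upS r) p).
Proof.
  unfold instS; rewrite !subst_comp; apply subst_ext.
  - intros n; simpl. symmetry; apply tsubst_Var.
  - intros [|n]; reflexivity.
Qed.

Lemma inst_subst_up s r t p :
  inst t (subst (up s) r p) = subst (scons t s) r p.
Proof.
  unfold inst; rewrite subst_comp; apply subst_ext; auto.
  intros [|n]; simpl; auto.
  unfold tshift; rewrite tsubst_comp; apply tsubst_Var.
Qed.

Lemma instS_subst_upS s r X p :
  instS X (subst s (upS r) p) = subst s (scons X r) p.
Proof.
  unfold instS; rewrite subst_comp; apply subst_ext.
  - intros n; apply tsubst_Var.
  - intros [|n]; reflexivity.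
Qed.

Lemma shift_subst s r p : subst (up s) r (shift p) = shift (subst s r p).
Proof. unfold shift; rewrite !subst_comp; reflexivity. Qed.

Lemma shiftS_subst s r p : subst s (upS r) (shiftS p) = shiftS (subst s r p).
Proof.
  unfold shiftS; rewrite !subst_comp; apply subst_ext; auto.
  intros n; simpl; symmetry; apply tsubst_Var.
Qed.

(** * Derivations *)

Section Derivations.

Variable Ax : form -> Prop.
Hypothesis Ax_subst : forall s r p, Ax p -> Ax (subst s r p).

Lemma prv_weaken G p : prv Ax G p -> forall G', incl G G' -> prv Ax G' p.
Proof.
  induction 1; intros G' Hi.
  - apply prv_axiom; auto.
  - apply prv_hyp; auto.
  - apply prv_impI, IHprv. intros x [->|Hx]; simpl; auto.
  - eapply prv_impE; eauto.
  - apply prv_dne; auto.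
  - apply prv_allI, IHprv, incl_map, Hi.
  - apply prv_allE; auto.
  - apply prv_allSI, IHprv, incl_map, Hi.
  - apply prv_allSE; auto.
  - apply prv_eqI.
  - eapply prv_eqE; eauto.
Qed.

(** Closure of the axioms under substitution is exactly the axiom case. The lemma serves to turn a
    fresh free variable into the variable bound by a quantifier. *)
Lemma prv_subst G p :
  prv Ax G p -> forall s r, prv Ax (map (subst s r) G) (subst s r p).
Proof.
  induction 1; intros s' r'.
  - apply prv_axiom; auto.
  - apply prv_hyp, in_map; auto.
  - apply prv_impI, IHprv.
  - eapply prv_impE; [apply IHprv1|apply IHprv2].
  - apply prv_dne, IHprv.
  - simpl. apply prv_allI.
    specialize (IHprv (up s') r'). rewrite map_map in *.
    erewrite map_ext; [exact IHprv|]. intros q; symmetry; apply shift_subst.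
  - rewrite subst_inst. apply prv_allE, IHprv.
  - simpl. apply prv_allSI.
    specialize (IHprv s' (upS r')). rewrite map_map in *.
    erewrite map_ext; [exact IHprv|]. intros q; symmetry; apply shiftS_subst.
  - rewrite subst_instS. apply prv_allSE, IHprv.
  - apply prv_eqI.
  - rewrite subst_inst. apply prv_eqE with (s := tsubst s' s).
    + apply IHprv1.
    + rewrite <- subst_inst. apply IHprv2.
Qed.

Lemma prv_by_contradiction G p : prv Ax (Neg p :: G) Bot -> prv Ax G p.
Proof. intros H. apply prv_dne, prv_impI, H. Qed.

Lemma prv_bot G p : prv Ax G Bot -> prv Ax G p.
Proof.
  intros H. apply prv_by_contradiction. eapply prv_weaken; [exact H|].
  intros x Hx; right; exact Hx.
Qed.

(** A semantic way to say that all free variables of [p], of both sorts, are below [k]; it avoids an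
    inductive account of free occurrences. *)
Definition bounded_by (k : nat) (p : form) : Prop :=
  forall s s' r r',
    (forall n, n < k -> s n = s' n) -> (forall n, n < k -> r n = r' n) ->
    subst s r p = subst s' r' p.

Lemma bounded_tsubst t : exists k, forall s s',
  (forall n, n < k -> s n = s' n) -> tsubst s t = tsubst s' t.
Proof.
  induction t as [n| | |t1 [k1 H1] t2 [k2 H2]|t1 [k1 H1] t2 [k2 H2]].
  - exists (S n); simpl; intros s s' H; apply H; lia.
  - exists 0; reflexivity.
  - exists 0; reflexivity.
  - exists (k1 + k2); simpl; intros s s' H; f_equal;
      [apply H1|apply H2]; intros n Hn; apply H; lia.
  - exists (k1 + k2); simpl; intros s s' H; f_equal;
      [apply H1|apply H2]; intros n Hn; apply H; lia.
Qed.

Lemma bounded_form p : exists k, bounded_by k p.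
Proof.
  induction p as [s t|s t|t X| |p [k1 H1] q [k2 H2]|p [k H]|p [k H]].
  - destruct (bounded_tsubst s) as [k1 H1], (bounded_tsubst t) as [k2 H2].
    exists (k1 + k2); intros s1 s2 r1 r2 Hs _; simpl; f_equal;
      [apply H1|apply H2]; intros n Hn; apply Hs; lia.
  - destruct (bounded_tsubst s) as [k1 H1], (bounded_tsubst t) as [k2 H2].
    exists (k1 + k2); intros s1 s2 r1 r2 Hs _; simpl; f_equal;
      [apply H1|apply H2]; intros n Hn; apply Hs; lia.
  - destruct (bounded_tsubst t) as [k H].
    exists (k + S X); intros s1 s2 r1 r2 Hs Hr; simpl; f_equal.
    + apply H; intros n Hn; apply Hs; lia.
    + apply Hr; lia.
  - exists 0; intros s1 s2 r1 r2 _ _; reflexivity.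
  - exists (k1 + k2); intros s1 s2 r1 r2 Hs Hr; simpl; f_equal;
      [apply H1|apply H2]; intros n Hn; (apply Hs || apply Hr); lia.
  - exists k; intros s1 s2 r1 r2 Hs Hr; simpl; f_equal. apply H; auto.
    intros [|n] Hn; simpl; auto. rewrite Hs by lia; reflexivity.
  - exists k; intros s1 s2 r1 r2 Hs Hr; simpl; f_equal. apply H; auto.
    intros [|n] Hn; simpl; auto. rewrite Hr by lia; reflexivity.
Qed.

Lemma bounded_context G : exists k, forall p, In p G -> bounded_by k p.
Proof.
  induction G as [|q G [k Hk]].
  - exists 0; intros p [].
  - destruct (bounded_form q) as [l Hl]. exists (k + l).
    intros p [<-|Hp] s s' r r' Hs Hr.
    + apply Hl; intros n Hn; (apply Hs || apply Hr); lia.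
    + apply (Hk p Hp); intros n Hn; (apply Hs || apply Hr); lia.
Qed.

(* The renaming that exchanges the fresh variable [k] for [0] and shifts the
   others acts on [G] as [shift]. *)
Lemma prv_allI_fresh G q :
  exists t, prv Ax G (inst t q) -> prv Ax G (All q).
Proof.
  destruct (bounded_context (q :: G)) as [k Hk].
  exists (Var k); intros H.
  pose (s := fun n => if n =? k then Var 0 else Var (S n)).
  apply prv_allI.
  apply prv_subst with (s := s) (r := fun X => X) in H.
  replace (map shift G) with (map (subst s (fun X => X)) G).
  - replace q with (subst s (fun X => X) (inst (Var k) q)); [exact H|].
    unfold inst; rewrite subst_comp. rewrite <- (subst_Var q) at 2.
    apply (Hk q (or_introl eq_refl)); auto.
    intros [|n] Hn; simpl; unfold s.
    + rewrite Nat.eqb_refl; reflexivity.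
    + destruct (Nat.eqb_spec n k); [lia|reflexivity].
  - apply map_ext_in; intros p Hp. apply (Hk p (or_intror Hp)); auto.
    intros n Hn; unfold s. destruct (Nat.eqb_spec n k); [lia|reflexivity].
Qed.

Lemma prv_allSI_fresh G q :
  exists X, prv Ax G (instS X q) -> prv Ax G (AllSet q).
Proof.
  destruct (bounded_context (q :: G)) as [k Hk].
  exists k; intros H.
  pose (r := fun n => if n =? k then 0 else S n).
  apply prv_allSI.
  apply prv_subst with (s := Var) (r := r) in H.
  replace (map shiftS G) with (map (subst Var r) G).
  - replace q with (subst Var r (instS k q)); [exact H|].
    unfold instS; rewrite subst_comp. rewrite <- (subst_Var q) at 2.
    apply (Hk q (or_introl eq_refl)); auto.
    intros [|n] Hn; simpl; unfold r.
    + rewrite Nat.eqb_refl; reflexivity.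
    + destruct (Nat.eqb_spec n k); [lia|reflexivity].
  - apply map_ext_in; intros p Hp. apply (Hk p (or_intror Hp)); auto.
    intros n Hn; unfold r. destruct (Nat.eqb_spec n k); [lia|reflexivity].
Qed.

(** * Consistent extensions with witnesses *)

Definition consistent (G : list form) : Prop := ~ prv Ax G Bot.

(** A refuted universal formula must come with a refuted instance. As [Ex] and [ExSet] abbreviate
    negated universals, this is the whole Henkin property. *)
Definition decides (p : form) (G : list form) : Prop :=
  prv Ax G p \/
  prv Ax G (Neg p) /\
  (forall q, p = All q -> exists t, prv Ax G (Neg (inst t q))) /\
  (forall q, p = AllSet q -> exists X, prv Ax G (Neg (instS X q))).

(** If [p] cannot be added, then its negation is derivable. For universal [p] the negation of a
    fresh instance is added: were this inconsistent, the fresh instance and hence [p] itself would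
    be derivable. *)
Lemma consistent_extension p G :
  consistent G -> exists G', incl G G' /\ consistent G' /\ decides p G'.
Proof.
  intros Hc.
  destruct (classic (consistent (p :: G))) as [Hp|Hp].
  { exists (p :: G); split; [apply incl_tl, incl_refl|split; auto].
    left; apply prv_hyp; left; reflexivity. }
  apply NNPP in Hp. apply prv_impI in Hp.
  assert (Hd : decides p G -> exists G', incl G G' /\ consistent G' /\ decides p G').
  { intros; exists G; split; [apply incl_refl|auto]. }
  assert (Hw : forall q, q = Neg p -> forall l, prv Ax (l :: G) (Neg p)).
  { intros q _ l; eapply prv_weaken; [exact Hp|apply incl_tl, incl_refl]. }
  destruct p as [| | | | |q|q];
    try (apply Hd; right; split; [exact Hp|split; intros; discriminate]).
  - destruct (prv_allI_fresh G q) as [t Ht].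
    exists (Neg (inst t q) :: G).
    split; [apply incl_tl, incl_refl|split].
    + intros H. apply Hc. eapply prv_impE; [exact Hp|].
      apply Ht, prv_by_contradiction, H.
    + right; split; [eapply Hw; reflexivity|split; [|intros; discriminate]].
      intros q' E; injection E as <-. exists t; apply prv_hyp; left; reflexivity.
  - destruct (prv_allSI_fresh G q) as [X HX].
    exists (Neg (instS X q) :: G).
    split; [apply incl_tl, incl_refl|split].
    + intros H. apply Hc. eapply prv_impE; [exact Hp|].
      apply HX, prv_by_contradiction, H.
    + right; split; [eapply Hw; reflexivity|split; [intros; discriminate|]].
      intros q' E; injection E as <-. exists X; apply prv_hyp; left; reflexivity.
Qed.

End Derivations.

(** * Countability of the set of formulas *)

Fixpoint term_code (t : term) : nat :=
  match t with
  | Var n => to_nat (0, n)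
  | Zero => to_nat (1, 0)
  | One => to_nat (2, 0)
  | Plus s t => to_nat (3, to_nat (term_code s, term_code t))
  | Times s t => to_nat (4, to_nat (term_code s, term_code t))
  end.

Fixpoint form_code (p : form) : nat :=
  match p with
  | Eq s t => to_nat (0, to_nat (term_code s, term_code t))
  | Lt s t => to_nat (1, to_nat (term_code s, term_code t))
  | Mem t X => to_nat (2, to_nat (term_code t, X))
  | Bot => to_nat (3, 0)
  | Imp p q => to_nat (4, to_nat (form_code p, form_code q))
  | All p => to_nat (5, form_code p)
  | AllSet p => to_nat (6, form_code p)
  end.

Local Opaque to_nat.

Lemma term_code_inj s t : term_code s = term_code t -> s = t.
Proof.
  revert t; induction s; intros []; cbn [term_code]; intros H;
    apply to_nat_inj in H; try discriminate H; try injection H as H;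
    try (apply to_nat_inj in H; injection H as H1 H2); f_equal; auto.
Qed.

Lemma form_code_inj p q : form_code p = form_code q -> p = q.
Proof.
  revert q; induction p; intros []; cbn [form_code]; intros H;
    apply to_nat_inj in H; try discriminate H; try injection H as H;
    try (apply to_nat_inj in H; injection H as H1 H2); f_equal;
    auto using term_code_inj.
Qed.

(** A left inverse of the coding. Its value at a number that is no code is arbitrary, which only
    makes the Henkin sequence decide some further formula at that stage. *)
Definition form_of (n : nat) : form :=
  epsilon (inhabits Bot) (fun p => form_code p = n).

Lemma form_of_code p : form_of (form_code p) = p.
Proof.
  apply form_code_inj. unfold form_of.
  apply (epsilon_spec (inhabits Bot) (fun q => form_code q = form_code p)).
  exists p; reflexivity.
Qed.

(** * Models and completeness *)

Record structure : Type := Structure {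
  dom :> Type;
  sets : Type;
  zero : dom;
  one : dom;
  add : dom -> dom -> dom;
  mul : dom -> dom -> dom;
  lt : dom -> dom -> Prop;
  mem : dom -> sets -> Prop
}.

Arguments zero {_}.
Arguments one {_}.
Arguments add {_} _ _.
Arguments mul {_} _ _.
Arguments lt {_} _ _.
Arguments mem {_} _ _.

Fixpoint eval {M : structure} (v : nat -> M) (t : term) : M :=
  match t with
  | Var n => v n
  | Zero => zero
  | One => one
  | Plus s t => add (eval v s) (eval v t)
  | Times s t => mul (eval v s) (eval v t)
  end.

Fixpoint sat {M : structure} (v : nat -> M) (w : nat -> sets M) (p : form) : Prop :=
  match p with
  | Eq s t => eval v s = eval v t
  | Lt s t => lt (eval v s) (eval v t)
  | Mem t X => mem (eval v t) (w X)
  | Bot => False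
  | Imp p q => sat v w p -> sat v w q
  | All p => forall x, sat (scons x v) w p
  | AllSet p => forall X, sat v (scons X w) p
  end.

Section Completeness.

Variable Ax : form -> Prop.
Hypothesis Ax_subst : forall s r p, Ax p -> Ax (subst s r p).

Section TermModel.

Variable G0 : list form.
Hypothesis G0_consistent : consistent Ax G0.

Lemma henkin_sequence : exists G : nat -> list form,
  G 0 = G0 /\ forall n,
    incl (G n) (G (S n)) /\ consistent Ax (G n) /\ decides Ax (form_of n) (G (S n)).
Proof.
  pose (T := {G | consistent Ax G}).
  (* The recursion needs the next context as a value, so the mere existence of an extension is
     turned into a choice, with consistency packed into [T]. *)
  assert (ext : forall n (G : T), {G' : T |
     incl (proj1_sig G) (proj1_sig G') /\ decides Ax (form_of n) (proj1_sig G')}).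
  { intros n [G HG]. apply constructive_indefinite_description.
    destruct (consistent_extension Ax Ax_subst (form_of n) G HG) as (G' & H1 & H2 & H3).
    exists (exist _ G' H2); auto. }
  pose (G := fix G n : T := match n with
     0 => exist _ G0 G0_consistent | S n => proj1_sig (ext n (G n)) end).
  exists (fun n => proj1_sig (G n)). split; [reflexivity|]. intros n.
  destruct (proj2_sig (ext n (G n))) as [H1 H2].
  split; [exact H1|split; [exact (proj2_sig (G n))|exact H2]].
Qed.

(** [T] is what the union of the chain proves. Any two members are already derivable at a common
    stage, and the listed equivalences are the clauses that the truth lemma of the term model
    needs. *)
Lemma henkin_theory : exists T : form -> Prop,
  (forall p, In p G0 -> T p) /\
  (forall p, prv Ax [] p -> T p) /\
  ~ T Bot /\
  (forall p q, T (Imp p q) <-> (T p -> T q)) /\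
  (forall p, T (All p) <-> forall t, T (inst t p)) /\
  (forall p, T (AllSet p) <-> forall X, T (instS X p)) /\
  (forall p s t, T (Eq s t) -> T (inst s p) -> T (inst t p)).
Proof.
  destruct henkin_sequence as (G & E0 & HG).
  assert (mono : forall m n, m <= n -> incl (G m) (G n)).
  { induction 1; [apply incl_refl|].
    eapply incl_tran; [eassumption|apply HG]. }
  pose (T := fun p => exists n, prv Ax (G n) p).
  assert (two : forall p q, T p -> T q -> exists n, prv Ax (G n) p /\ prv Ax (G n) q).
  { intros p q [m Hm] [n Hn]. exists (m + n).
    split; [eapply prv_weaken; [exact Hm|]|eapply prv_weaken; [exact Hn|]];
      apply mono; lia. }
  assert (con : ~ T Bot).
  { intros [n Hn]. exact (proj1 (proj2 (HG n)) Hn). }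
  assert (dec : forall p, T p \/ T (Neg p) /\
    (forall q, p = All q -> exists t, T (Neg (inst t q))) /\
    (forall q, p = AllSet q -> exists X, T (Neg (instS X q)))).
  { intros p. destruct (HG (form_code p)) as (_ & _ & [H|(H1 & H2 & H3)]);
      rewrite form_of_code in *; [left; eexists; eassumption|right].
    split; [eexists; eassumption|split; intros q Hq].
    - destruct (H2 q Hq) as [t Ht]; exists t; eexists; eassumption.
    - destruct (H3 q Hq) as [X HX]; exists X; eexists; eassumption. }
  assert (mp : forall p q, T (Imp p q) -> T p -> T q).
  { intros p q H1 H2. destruct (two _ _ H1 H2) as (n & Ha & Hb).
    exists n; eapply prv_impE; eassumption. }
  exists T. repeat split.
  - intros p Hp; exists 0; rewrite E0; apply prv_hyp, Hp.
  - intros p Hp; exists 0; eapply prv_weaken; [exact Hp|]. intros x [].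
  - exact con.
  - intros; eauto.
  - intros H. destruct (dec p) as [Hp|[[n Hn] _]].
    + destruct (H Hp) as [n Hn]; exists n. apply prv_impI.
      eapply prv_weaken; [exact Hn|apply incl_tl, incl_refl].
    + exists n. apply prv_impI, prv_bot.
      eapply prv_impE; [|apply prv_hyp; left; reflexivity].
      eapply prv_weaken; [exact Hn|apply incl_tl, incl_refl].
  - intros [n Hn] t; exists n; apply prv_allE, Hn.
  - intros H. destruct (dec (All p)) as [Hp|(_ & H2 & _)]; [exact Hp|exfalso].
    destruct (H2 p eq_refl) as [t Ht]. exact (con (mp _ _ Ht (H t))).
  - intros [n Hn] t; exists n; apply prv_allSE, Hn.
  - intros H. destruct (dec (AllSet p)) as [Hp|(_ & _ & H2)]; [exact Hp|exfalso].
    destruct (H2 p eq_refl) as [t Ht]. exact (con (mp _ _ Ht (H t))).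
  - intros p s t H1 H2. destruct (two _ _ H1 H2) as (n & Ha & Hb).
    exists n; eapply prv_eqE; eassumption.
Qed.

(* The domain consists of one chosen representative of each class of terms
   that the Henkin theory proves equal. *)
Lemma model_existence : exists (M : structure) (v : nat -> M) (w : nat -> sets M),
  (forall p, In p G0 -> sat v w p) /\ (forall p, Ax p -> forall v w, @sat M v w p).
Proof.
  destruct henkin_theory as (T & HG & Hprv & Hbot & Himp & Hall & HallS & Heq).
  assert (Hrefl : forall t, T (Eq t t)) by (intros; apply Hprv, prv_eqI).
  assert (Hsym : forall s t, T (Eq s t) -> T (Eq t s)).
  (* Symmetry is Leibniz replacement in the formula stating that the variable equals [s]. *)
  { intros s t H. specialize (Heq (Eq (Var 0) (tshift s)) s t H).
    unfold inst, tshift in Heq; simpl in Heq.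
    rewrite !tsubst_comp in Heq; simpl in Heq; rewrite !tsubst_Var in Heq.
    apply Heq, Hrefl. }
  assert (Hcong : forall p s t, T (Eq s t) -> (T (inst s p) <-> T (inst t p))).
  { intros p s t H; split; apply Heq; auto. }
  assert (Htrans : forall s t u, T (Eq s t) -> (T (Eq s u) <-> T (Eq t u))).
  { intros s t u H. specialize (Hcong (Eq (Var 0) (tshift u)) s t H).
    unfold inst, tshift in Hcong; simpl in Hcong.
    rewrite !tsubst_comp in Hcong; simpl in Hcong; rewrite !tsubst_Var in Hcong.
    exact Hcong. }
  pose (rep t := epsilon (inhabits Zero) (fun u => T (Eq t u))).
  assert (rep_spec : forall t, T (Eq t (rep t))).
  { intros t. apply (epsilon_spec (inhabits Zero) (fun u => T (Eq t u))). exists t; auto. }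
  (* Provably equal terms have extensionally, hence literally, the same predicate under [epsilon],
     so they receive the same representative. *)
  assert (rep_eq : forall s t, T (Eq s t) -> rep s = rep t).
  { intros s t H. unfold rep. f_equal. apply functional_extensionality; intros u.
    apply propositional_extensionality, Htrans, H. }
  pose (D := {t | exists s, t = rep s}).
  pose (cls := fun t => exist _ (rep t) (ex_intro _ t eq_refl) : D).
  assert (cls_eq : forall s t, cls s = cls t <-> T (Eq s t)).
  { intros s t; split; intros H.
    - apply (f_equal (@proj1_sig _ _)) in H; simpl in H.
      apply Hsym. apply Htrans with (s := rep t); [apply Hsym, rep_spec|].
      rewrite <- H. apply Hsym, rep_spec.
    - apply eq_sig_hprop; [intros; apply proof_irrelevance|]. apply rep_eq, H. }
  assert (cls_onto : forall d : D, exists t, d = cls t).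
  { intros [t [s ->]]; exists s; reflexivity. }
  (* The sets are the set variables themselves: the language has no equality between sets, so no
     quotient is taken in that sort. *)
  pose (M := Structure D nat (cls Zero) (cls One)
     (fun x y => cls (Plus (proj1_sig x) (proj1_sig y)))
     (fun x y => cls (Times (proj1_sig x) (proj1_sig y)))
     (fun x y => T (Lt (proj1_sig x) (proj1_sig y)))
     (fun x X => T (Mem (proj1_sig x) X))).
  assert (two : forall (p : form) s s' t t',
     T (Eq s s') -> T (Eq t t') ->
     (T (subst (scons s (scons t Var)) (fun X => X) p) <->
      T (subst (scons s' (scons t' Var)) (fun X => X) p))).
  { intros p s s' t t' Hs Ht.
    transitivity (T (subst (scons s' (scons t Var)) (fun X => X) p)).
    - rewrite <- !(inst_subst_up (scons t Var)). apply Hcong, Hs.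
    (* [u] fills the first slot with [s'] and makes the second slot variable 0, so that one-variable
       congruence applies to it. *)
    - pose (u n := match n with 0 => tshift s' | 1 => Var 0 | S (S n) => Var (S n) end).
      pose (q := subst u (fun X => X) p).
      assert (E : forall t, subst (scons s' (scons t Var)) (fun X => X) p = inst t q).
      { intros t1; unfold q, inst. rewrite subst_comp; apply subst_ext; auto.
        intros [|[|n]]; simpl; auto.
        unfold tshift; rewrite tsubst_comp; symmetry; apply tsubst_Var. }
      rewrite !E. apply Hcong, Ht. }
  assert (Hop : forall op, (op = Plus \/ op = Times) ->
     forall s s' t t', T (Eq s s') -> T (Eq t t') -> T (Eq (op s t) (op s' t'))).
  { intros op Hop s s' t t' Hs Ht.
    specialize (two (Eq (op (Var 0) (Var 1)) (tshift (tshift (op s' t')))) s s' t t' Hs Ht).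
    unfold tshift in two.
    destruct Hop as [-> | ->]; simpl in two; rewrite !tsubst_comp in two;
      simpl in two; rewrite !tsubst_Var in two; apply two, Hrefl. }
  assert (evalE : forall s t, @eval M (fun n => cls (s n)) t = cls (tsubst s t)).
  { intros s t; induction t; simpl; auto; rewrite IHt1, IHt2;
      apply cls_eq, Hop; auto; apply Hsym, rep_spec. }
  assert (sconsE : forall t s,
     @scons M (cls t) (fun n => cls (s n)) = fun n => cls (scons t s n)).
  { intros t s; apply functional_extensionality; intros [|n]; reflexivity. }
  assert (truth : forall p s r, @sat M (fun n => cls (s n)) r p <-> T (subst s r p)).
  { induction p as [a b|a b|a X| |p IHp q IHq|p IHp|p IHp]; intros s r; cbn [sat subst].
    - rewrite !evalE. apply cls_eq.
    - rewrite !evalE. simpl.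
      apply (two (Lt (Var 0) (Var 1))); apply Hsym, rep_spec.
    - rewrite !evalE. simpl.
      apply (two (Mem (Var 0) (r X)) _ _ Zero Zero); auto.
    - tauto.
    - rewrite IHp, IHq, Himp. reflexivity.
    - rewrite Hall. split.
      + intros H t. rewrite inst_subst_up. apply (IHp (scons t s) r).
        rewrite <- sconsE; apply H.
      + intros H x. destruct (cls_onto x) as [t ->].
        rewrite sconsE. apply (IHp (scons t s) r). rewrite <- inst_subst_up. apply H.
    - rewrite HallS. split; intros H X.
      + rewrite instS_subst_upS. apply (IHp s (scons X r)), H.
      + apply (IHp s (scons X r)). rewrite <- instS_subst_upS. apply H. }
  exists M, (fun n => cls (Var n)), (fun X => X). split.
  - intros p Hp. apply truth. rewrite subst_Var. apply HG, Hp.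
  - intros p Hp v w.
    (* Every assignment is named by a substitution of terms, and the substituted axiom is again an
       axiom. *)
    destruct (choice (fun n t => v n = cls t) (fun n => cls_onto (v n))) as [s Hs].
    replace v with (fun n => cls (s n)).
    + apply truth, Hprv, prv_axiom, Ax_subst, Hp.
    + apply functional_extensionality; intros n; symmetry; apply Hs.
Qed.

End TermModel.

Theorem completeness p :
  (forall M : structure, (forall a, Ax a -> forall v w, @sat M v w a) ->
     forall v w, @sat M v w p) ->
  prv Ax [] p.
Proof.
  intros H. apply NNPP; intros Hn.
  destruct (model_existence [Neg p]) as (M & v & w & H1 & H2).
  { intros Hb. apply Hn, prv_by_contradiction, Hb. }
  exact (H1 (Neg p) (or_introl eq_refl) (H M H2 v w)).
Qed.

End Completeness.

(** * Closure of RCA_0 under substitution *)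

Lemma Sigma00_subst p : Sigma00 p -> forall s r, Sigma00 (subst s r p).
Proof.
  induction 1; intros s' r'; simpl; try (constructor; auto; fail).
  - rewrite tshift_up. constructor; auto.
  - change (Sigma00 (Ex (And (Lt (Var 0) (tsubst (up s') (tshift t)))
                             (subst (up s') r' p)))).
    rewrite tshift_up. apply S00_bex; auto.
Qed.

Lemma RCA0_subst s r p : RCA0 p -> RCA0 (subst s r p).
Proof.
  intros H; destruct H as [p H|p (q & Hq & ->)|p q (p' & Hp & ->) (q' & Hq & ->)].
  (* The basic axioms are sentences, so substitution computes to the identity on each of them. *)
  - replace (subst s r p) with p; [apply RCA0_basic, H|].
    simpl in H; repeat destruct H as [<-|H]; try reflexivity; destruct H.
  - replace (subst s r (induction (Ex q)))
      with (induction (Ex (subst (up (up s)) r q))).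
    + apply RCA0_induction. eexists; split; [apply Sigma00_subst, Hq|reflexivity].
    + set (p := Ex q). change (Ex (subst (up (up s)) r q)) with (subst (up s) r p).
      clearbody p. pose (succ := scons (Plus (Var 0) One) (fun n => Var (S n))).
      assert (E : subst (up s) r (subst succ (fun X => X) p)
                  = subst succ (fun X => X) (subst (up s) r p)).
      { rewrite !subst_comp. apply subst_ext; auto.
        intros [|n]; simpl; auto. unfold tshift; rewrite !tsubst_comp; reflexivity. }
      unfold induction, And, Neg. cbn [subst].
      fold succ. rewrite E, subst_inst. reflexivity.
  - replace (subst s r (comprehension (Ex p') (All q')))
      with (comprehension (Ex (subst (up (up s)) r p')) (All (subst (up (up s)) r q'))).
    + apply RCA0_comprehension; eexists; (split; [|reflexivity]);
        apply Sigma00_subst; assumption.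
    + set (p := Ex p'). change (Ex (subst (up (up s)) r p')) with (subst (up s) r p).
      clearbody p. unfold comprehension, Iff, And, ExSet, Neg. cbn [subst].
      rewrite !shiftS_subst. reflexivity.
Qed.

(** * Bounded definability in a structure *)

Lemma eval_tsubst (M : structure) (v : nat -> M) s t :
  eval v (tsubst s t) = eval (fun n => eval v (s n)) t.
Proof. induction t; simpl; congruence. Qed.

Lemma eval_up (M : structure) (v : nat -> M) s x :
  (fun n => eval (scons x v) (up s n)) = scons x (fun n => eval v (s n)).
Proof.
  apply functional_extensionality; intros [|n]; simpl; auto.
  unfold tshift; rewrite eval_tsubst; reflexivity.
Qed.

Lemma scons_upS (A : Type) (w : nat -> A) r X :
  (fun n => scons X w (upS r n)) = scons X (fun n => w (r n)).
Proof. apply functional_extensionality; intros [|n]; reflexivity. Qed.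

Lemma sat_subst (M : structure) p : forall (v : nat -> M) w s r,
  sat v w (subst s r p) <-> sat (fun n => eval v (s n)) (fun X => w (r X)) p.
Proof.
  induction p as [a b|a b|a X| |p IHp q IHq|p IHp|p IHp]; intros v w s r; simpl;
    rewrite ?eval_tsubst; try reflexivity.
  - rewrite IHp, IHq; reflexivity.
  - split; intros H x; specialize (H x); [rewrite <- eval_up; apply IHp, H|].
    apply IHp. rewrite eval_up. exact H.
  - split; intros H X; specialize (H X); [rewrite <- scons_upS; apply IHp, H|].
    apply IHp. rewrite scons_upS. exact H.
Qed.

Section Definability.

Variable M : structure.
(** Even a formula without set parameters is evaluated under an assignment of the set variables;
    [X0] is its default value. *)
Variable X0 : sets M.

(* An assignment [e] sends each variable of a formula to a coordinate of the
   argument or to a parameter. *)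
Definition look (e : nat -> nat + M) (v : nat -> M) (n : nat) : M :=
  match e n with inl k => v k | inr c => c end.

Definition definable_term (t : (nat -> M) -> M) : Prop :=
  exists u e, forall v, t v = eval (look e v) u.

(** Number and set parameters from the model are absorbed by [e] and [w], so predicates can mention
    arbitrary elements and sets without any bookkeeping of indices. *)
Definition definable (P : (nat -> M) -> Prop) : Prop :=
  exists p e w, Sigma00 p /\ forall v, P v <-> sat (look e v) w p.

(** Merges the assignments of two formulas into one: the variables of the first move to even
    indices, those of the second to odd ones. *)
Definition interleave {A : Type} (f g : nat -> A) (n : nat) : A :=
  if Nat.even n then f (Nat.div2 n) else g (Nat.div2 n).

Lemma interleave_even (A : Type) (f g : nat -> A) n : interleave f g (2 * n) = f n.
Proof. unfold interleave. rewrite Nat.even_even, Nat.div2_double. reflexivity. Qed.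

Lemma interleave_odd (A : Type) (f g : nat -> A) n : interleave f g (S (2 * n)) = g n.
Proof.
  unfold interleave. replace (S (2 * n)) with (2 * n + 1) at 1 by lia.
  rewrite Nat.even_odd, Nat.div2_succ_double. reflexivity.
Qed.

Definition evens (n : nat) : term := Var (2 * n).
Definition odds (n : nat) : term := Var (S (2 * n)).

Lemma look_evens e e' v :
  (fun n => eval (look (interleave e e') v) (evens n)) = look e v.
Proof.
  apply functional_extensionality; intros n; cbn [eval evens]; unfold look.
  rewrite interleave_even. reflexivity.
Qed.

Lemma look_odds e e' v :
  (fun n => eval (look (interleave e e') v) (odds n)) = look e' v.
Proof.
  apply functional_extensionality; intros n; cbn [eval odds]; unfold look.
  rewrite interleave_odd. reflexivity.
Qed.

Lemma definable_var k : definable_term (fun v => v k).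
Proof. exists (Var 0), (fun _ => inl k). reflexivity. Qed.

Lemma definable_const c : definable_term (fun _ => c).
Proof. exists (Var 0), (fun _ => inr c). reflexivity. Qed.

Lemma definable_add s t :
  definable_term s -> definable_term t -> definable_term (fun v => add (s v) (t v)).
Proof.
  intros (a & e & Ha) (b & e' & Hb).
  exists (Plus (tsubst evens a) (tsubst odds b)), (interleave e e'); intros v; simpl.
  rewrite !eval_tsubst, look_evens, look_odds, Ha, Hb. reflexivity.
Qed.

Lemma definable_mul s t :
  definable_term s -> definable_term t -> definable_term (fun v => mul (s v) (t v)).
Proof.
  intros (a & e & Ha) (b & e' & Hb).
  exists (Times (tsubst evens a) (tsubst odds b)), (interleave e e'); intros v; simpl.
  rewrite !eval_tsubst, look_evens, look_odds, Ha, Hb. reflexivity.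
Qed.

Lemma definable_ext P Q : (forall v, P v <-> Q v) -> definable P -> definable Q.
Proof.
  intros H (p & e & w & Hp & E). exists p, e, w; split; [exact Hp|].
  intros v; rewrite <- H; apply E.
Qed.

Lemma definable_eq s t :
  definable_term s -> definable_term t ->
  definable (fun v => s v = t v).
Proof.
  intros (a & e & Ha) (b & e' & Hb).
  exists (Eq (tsubst evens a) (tsubst odds b)), (interleave e e'), (fun _ => X0).
  split; [constructor|]. intros v; simpl.
  rewrite !eval_tsubst, look_evens, look_odds, Ha, Hb. reflexivity.
Qed.

Lemma definable_lt s t :
  definable_term s -> definable_term t ->
  definable (fun v => lt (s v) (t v)).
Proof.
  intros (a & e & Ha) (b & e' & Hb).
  exists (Lt (tsubst evens a) (tsubst odds b)), (interleave e e'), (fun _ => X0).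
  split; [constructor|]. intros v; simpl.
  rewrite !eval_tsubst, look_evens, look_odds, Ha, Hb. reflexivity.
Qed.

Lemma definable_mem t X : definable_term t -> definable (fun v => mem (t v) X).
Proof.
  intros (a & e & Ha). exists (Mem a 0), e, (fun _ => X).
  split; [constructor|]. intros v; simpl. rewrite Ha. reflexivity.
Qed.

Lemma definable_common P Q :
  definable P -> definable Q ->
  exists p q e w, Sigma00 p /\ Sigma00 q /\
    (forall v, P v <-> sat (look e v) w p) /\ (forall v, Q v <-> sat (look e v) w q).
Proof.
  intros (p & e & w & Hp & Ep) (q & e' & w' & Hq & Eq).
  exists (subst evens (fun X => 2 * X) p), (subst odds (fun X => S (2 * X)) q),
    (interleave e e'), (interleave w w').
  split; [apply Sigma00_subst, Hp|split; [apply Sigma00_subst, Hq|]].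
  split; intros v; rewrite sat_subst.
  - rewrite look_evens, Ep.
    replace (fun X => interleave w w' (2 * X)) with w; [reflexivity|].
    apply functional_extensionality; intros; rewrite interleave_even; reflexivity.
  - rewrite look_odds, Eq.
    replace (fun X => interleave w w' (S (2 * X))) with w'; [reflexivity|].
    apply functional_extensionality; intros; rewrite interleave_odd; reflexivity.
Qed.

Lemma definable_imp P Q :
  definable P -> definable Q -> definable (fun v => P v -> Q v).
Proof.
  intros HP HQ. destruct (definable_common P Q HP HQ) as (p & q & e & w & Hp & Hq & Ep & Eq).
  exists (Imp p q), e, w. split; [constructor; assumption|].
  intros v; simpl. rewrite Ep, Eq. reflexivity.
Qed.

Lemma definable_rename P f : definable P -> definable (fun v => P (fun n => v (f n))).
Proof.
  intros (p & e & w & Hp & E).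
  exists p, (fun n => match e n with inl k => inl (f k) | inr c => inr c end), w.
  split; [exact Hp|]. intros v. rewrite E.
  replace (look e (fun n => v (f n)))
    with (look (fun n => match e n with inl k => inl (f k) | inr c => inr c end) v);
    [reflexivity|].
  apply functional_extensionality; intros n; unfold look. destruct (e n); reflexivity.
Qed.

Lemma definable_ball t P :
  definable_term t -> definable (fun v => P (fun n => v (S n)) (v 0)) ->
  definable (fun v => forall x, lt x (t v) -> P v x).
Proof.
  intros (a & e & Ha) (p & e' & w & Hp & Ep).
  (* Coordinate 0 becomes the bound variable and the others move down by one. The value of [e1] at
     variables for coordinate 0 is a default: [s] sends these to the bound variable and never looks
     it up. *)
  pose (e1 := fun n => match e' n with inl (S k) => inl k | inl 0 => inl 0 | inr c => inr c end).
  pose (s := fun n => match e' n with inl 0 => Var 0 | _ => tshift (odds n) end).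
  exists (All (Imp (Lt (Var 0) (tshift (tsubst evens a))) (subst s (fun X => X) p))),
    (interleave e e1), w.
  split; [constructor; apply Sigma00_subst; assumption|]. intros v; cbn [sat eval].
  assert (Es : forall x, (fun n => eval (scons x (look (interleave e e1) v)) (s n))
                         = look e' (scons x v)).
  { intros x. apply functional_extensionality; intros n. unfold s, look at 2.
    pose proof (f_equal (fun f => f n) (look_odds e e1 v)) as E. cbv beta in E.
    unfold look at 2, e1 at 2 in E.
    destruct (e' n) as [[|k]|c]; [reflexivity| |];
      unfold tshift; rewrite eval_tsubst; exact E. }
  assert (Et : forall x, eval (scons x (look (interleave e e1) v)) (tshift (tsubst evens a))
                         = t v).
  { intros x. unfold tshift. rewrite Ha, !eval_tsubst, <- (look_evens e e1).
    reflexivity. }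
  split; intros H x; specialize (H x); specialize (Ep (scons x v)); cbn in Ep.
  - rewrite Et, sat_subst, Es. intros Hx. apply Ep, H, Hx.
  - rewrite Et, sat_subst, Es in H. intros Hx. apply Ep, H, Hx.
Qed.

Lemma definable_False : definable (fun _ => False).
Proof.
  exists Bot, (fun _ => inl 0), (fun _ => X0). split; [constructor|reflexivity].
Qed.

Lemma definable_not P : definable P -> definable (fun v => ~ P v).
Proof. intros H. apply (definable_imp P (fun _ => False)); auto using definable_False. Qed.

Lemma definable_and P Q :
  definable P -> definable Q -> definable (fun v => P v /\ Q v).
Proof.
  intros HP HQ.
  apply (definable_ext (fun v => ~ (P v -> ~ Q v))); [intros v; tauto|].
  apply definable_not, definable_imp, definable_not; auto.
Qed.

Lemma definable_or P Q :
  definable P -> definable Q -> definable (fun v => P v \/ Q v).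
Proof.
  intros HP HQ.
  apply (definable_ext (fun v => ~ P v -> Q v)); [intros v; tauto|].
  apply definable_imp; [apply definable_not|]; auto.
Qed.

Lemma definable_bex t P :
  definable_term t -> definable (fun v => P (fun n => v (S n)) (v 0)) ->
  definable (fun v => exists x, lt x (t v) /\ P v x).
Proof.
  intros Ht HP.
  apply (definable_ext (fun v => ~ forall x, lt x (t v) -> ~ P v x)).
  - intros v; split.
    + intros H. apply NNPP; intros Hn. apply H; intros x Hx Px; apply Hn; eauto.
    + intros (x & Hx & Px) H. exact (H x Hx Px).
  - apply definable_not, definable_ball; auto.
    apply (definable_not (fun v => P (fun n => v (S n)) (v 0))); auto.
Qed.

(** A condition that does not depend on the argument has a fixed truth value in the model, so its
    logical complexity does not matter. *)
Lemma definable_prop (A : Prop) : definable (fun _ => A).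
Proof.
  destruct (classic A) as [HA|HA].
  - apply (definable_ext (fun _ => False -> False)); [tauto|].
    apply definable_imp; apply definable_False; auto.
  - apply (definable_ext (fun _ => False)); [tauto|]. apply definable_False; auto.
Qed.

(** Returns from predicates to the formulas that the axiom schemes expect: variable 0 is the
    quantified witness, variable 1 the distinguished variable of the scheme, and all later ones hold
    parameters. *)
Lemma definable_formulas P Q : definable P -> definable Q ->
  exists p q v w, Sigma00 p /\ Sigma00 q /\ forall y x,
    (P (scons y (scons x (fun _ => zero))) <-> sat (scons y (scons x v)) w p) /\
    (Q (scons y (scons x (fun _ => zero))) <-> sat (scons y (scons x v)) w q).
Proof.
  intros HP HQ. destruct (definable_common P Q HP HQ) as (p & q & e & w & Hp & Hq & Ep & Eq).
  pose (s := fun n => match e n with inl 0 => Var 0 | inl 1 => Var 1 | _ => Var (S (S n)) end).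
  pose (v := fun n => match e n with inl _ => zero | inr c => c end).
  assert (E : forall y x, (fun n => eval (scons y (scons x v)) (s n))
                          = look e (scons y (scons x (fun _ => zero)))).
  { intros y x. apply functional_extensionality; intros n. unfold s, look.
    destruct (e n) as [[|[|k]]|c] eqn:En; simpl; auto; unfold v; rewrite En; reflexivity. }
  exists (subst s (fun X => X) p), (subst s (fun X => X) q), v, w.
  split; [apply Sigma00_subst, Hp|split; [apply Sigma00_subst, Hq|]].
  intros y x. rewrite Ep, Eq, !sat_subst, E. split; reflexivity.
Qed.

End Definability.

Arguments definable {M} _.
Arguments definable_term {M} _.

(** * Satisfaction of the defined connectives *)

Section Connectives.

Variables (M : structure) (v : nat -> M) (w : nat -> sets M).

Lemma sat_neg p P : (sat v w p <-> P) -> (sat v w (Neg p) <-> ~ P).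
Proof. simpl; tauto. Qed.

Lemma sat_top : sat v w (Neg Bot) <-> True.
Proof. simpl; tauto. Qed.

Lemma sat_imp p q P Q :
  (sat v w p <-> P) -> (sat v w q <-> Q) -> (sat v w (Imp p q) <-> (P -> Q)).
Proof. simpl; tauto. Qed.

Lemma sat_and p q P Q :
  (sat v w p <-> P) -> (sat v w q <-> Q) -> (sat v w (And p q) <-> P /\ Q).
Proof. simpl; tauto. Qed.

Lemma sat_or p q P Q :
  (sat v w p <-> P) -> (sat v w q <-> Q) -> (sat v w (Or p q) <-> P \/ Q).
Proof. simpl; tauto. Qed.

Lemma sat_iff p q P Q :
  (sat v w p <-> P) -> (sat v w q <-> Q) -> (sat v w (Iff p q) <-> (P <-> Q)).
Proof. simpl; tauto. Qed.

Lemma sat_all p (P : M -> Prop) :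
  (forall x, sat (scons x v) w p <-> P x) -> (sat v w (All p) <-> forall x, P x).
Proof. intros H; simpl; split; intros Hx x; apply H, Hx. Qed.

Lemma sat_ex p (P : M -> Prop) :
  (forall x, sat (scons x v) w p <-> P x) -> (sat v w (Ex p) <-> exists x, P x).
Proof.
  intros H; simpl; split.
  - intros Hn. apply NNPP; intros He. apply Hn; intros x Hx; apply He.
    exists x; apply H, Hx.
  - intros [x Hx] Hn. apply (Hn x), H, Hx.
Qed.

Lemma sat_allS p (P : sets M -> Prop) :
  (forall X, sat v (scons X w) p <-> P X) -> (sat v w (AllSet p) <-> forall X, P X).
Proof. intros H; simpl; split; intros Hx x; apply H, Hx. Qed.

Lemma sat_exS p (P : sets M -> Prop) :
  (forall X, sat v (scons X w) p <-> P X) -> (sat v w (ExSet p) <-> exists X, P X).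
Proof.
  intros H; simpl; split.
  - intros Hn. apply NNPP; intros He. apply Hn; intros x Hx; apply He.
    exists x; apply H, Hx.
  - intros [x Hx] Hn. apply (Hn x), H, Hx.
Qed.

End Connectives.

(* Proves [sat v w p <-> P] for a [P] that mirrors the connectives of [p]. *)
Ltac sat_mirror :=
  lazymatch goal with
  | |- _ <-> True => apply sat_top
  | |- _ <-> (_ <-> _) => apply sat_iff; sat_mirror
  | |- _ <-> (_ /\ _) => apply sat_and; sat_mirror
  | |- _ <-> (_ \/ _) => apply sat_or; sat_mirror
  | |- _ <-> ~ _ => apply sat_neg; sat_mirror
  | |- _ <-> (exists x : sets _, _) => apply sat_exS; intro; sat_mirror
  | |- _ <-> (exists x, _) => apply sat_ex; intro; sat_mirror
  | |- _ <-> (forall x : ?A, _) =>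
      lazymatch A with
      | sets _ => apply sat_allS; intro; sat_mirror
      | dom _ => apply sat_all; intro; sat_mirror
      | _ => apply sat_imp; sat_mirror
      end
  | |- _ => reflexivity
  end.

Declare Scope model_scope.
Delimit Scope model_scope with M.
Notation "0" := zero : model_scope.
Notation "1" := one : model_scope.
Notation "x + y" := (add x y) : model_scope.
Notation "x * y" := (mul x y) : model_scope.
Notation "x < y" := (lt x y) : model_scope.

Definition le {M : structure} (x y : M) : Prop := lt x y \/ x = y.
Notation "x <= y" := (le x y) : model_scope.

Definition mpair {M : structure} (i j : M) : M := ((i + j) * (i + j) + i)%M.
Definition mtriple {M : structure} (a b c : M) : M := mpair (mpair a b) c.

Ltac definability_term :=
  cbn beta;
  lazymatch goal with
  | |- definable_term (fun v => v ?k) => apply definable_var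
  | |- definable_term (fun _ => ?c) => apply definable_const
  | |- definable_term (fun v => add (@?s v) (@?t v)) =>
      apply (definable_add _ s t); definability_term
  | |- definable_term (fun v => mul (@?s v) (@?t v)) =>
      apply (definable_mul _ s t); definability_term
  | |- definable_term (fun v => mpair _ _) => unfold mpair; definability_term
  | |- definable_term (fun v => mtriple _ _ _) => unfold mtriple; definability_term
  end.

Ltac definability X0 :=
  cbn beta;
  lazymatch goal with
  | |- definable (fun _ => ?A) => apply (definable_prop _ X0)
  | |- definable (fun v => mem (@?t v) ?X) =>
      apply (definable_mem _ t X); definability_term
  | |- definable (fun v => lt (@?s v) (@?t v)) =>
      apply (definable_lt _ X0 s t); definability_term
  | |- definable (fun v => le (@?s v) (@?t v)) => unfold le; definability X0
  | |- definable (fun v => @?s v = @?t v) =>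
      apply (definable_eq _ X0 s t); definability_term
  | |- definable (fun v => @?P v /\ @?Q v) =>
      apply (definable_and _ X0 P Q); definability X0
  | |- definable (fun v => @?P v \/ @?Q v) =>
      apply (definable_or _ X0 P Q); definability X0
  | |- definable (fun v => ~ @?P v) => apply (definable_not _ X0 P); definability X0
  | |- definable (fun v => forall x, lt x (@?t v) -> @?P v x) =>
      apply (definable_ball _ t P); [definability_term|definability X0]
  | |- definable (fun v => exists x, lt x (@?t v) /\ @?P v x) =>
      apply (definable_bex _ X0 t P); [definability_term|definability X0]
  | |- definable (fun v => @?P v -> @?Q v) =>
      apply (definable_imp _ P Q); definability X0
  (* An abstract relation is known to be definable only in coordinates 1 and 0; renaming moves it to
     any other pair. *)
  | |- definable (fun v => ?R (v ?i) (v ?j)) =>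
      apply (definable_rename _ (fun v => R (v 1) (v 0)) (fun n => if n =? 0 then j else i));
      assumption
  end.

(** * Arithmetic in models of RCA_0 *)

Section Models.

Variable M : structure.
Hypothesis M_RCA0 : forall a, RCA0 a -> forall v w, @sat M v w a.
Variable X0 : sets M.

Local Open Scope model_scope.

(** The default [Neg Bot] holds in every model, so the position in the list needs no range check. *)
Lemma basic_axiom n P :
  (sat (fun _ => @zero M) (fun _ => X0) (nth n basic_axioms (Neg Bot)) <-> P) -> P.
Proof.
  intros H; apply H.
  destruct (nth_in_or_default n basic_axioms (Neg Bot)) as [Hn| ->].
  - apply M_RCA0, RCA0_basic, Hn.
  - simpl; auto.
Qed.

Lemma succ_inj (x y : M) : x + 1 = y + 1 -> x = y.
Proof. revert x y. apply (basic_axiom 1); sat_mirror. Qed.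
Lemma add_zero_r (x : M) : x + 0 = x.
Proof. revert x. apply (basic_axiom 2); sat_mirror. Qed.
Lemma add_succ_r (x y : M) : x + (y + 1) = (x + y) + 1.
Proof. revert x y. apply (basic_axiom 3); sat_mirror. Qed.
Lemma mul_zero_r (x : M) : x * 0 = 0.
Proof. revert x. apply (basic_axiom 4); sat_mirror. Qed.
Lemma mul_succ_r (x y : M) : x * (y + 1) = x * y + x.
Proof. revert x y. apply (basic_axiom 5); sat_mirror. Qed.
Lemma not_lt_zero (x : M) : ~ x < 0.
Proof. revert x. apply (basic_axiom 6); sat_mirror. Qed.
Lemma lt_succ (x y : M) : x < y + 1 <-> (x < y \/ x = y).
Proof. revert x y. apply (basic_axiom 7); sat_mirror. Qed.

Lemma sigma1_induction (Q : M -> M -> Prop) :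
  definable (fun v => Q (v 1%nat) (v 0%nat)) ->
  (exists y, Q 0 y) ->
  (forall x, (exists y, Q x y) -> exists y, Q (x + 1) y) ->
  forall x, exists y, Q x y.
Proof.
  intros HQ H0 Hs.
  destruct (definable_formulas _ _ _ HQ HQ) as (p & q & v & w & Hp & _ & E). cbn in E.
  assert (Ex_p : forall x, sat (scons x v) w (Ex p) <-> exists y, Q x y).
  { intros x; apply sat_ex; intros y; symmetry; apply E. }
  assert (Hi : sat v w (induction (Ex p))).
  { apply M_RCA0, RCA0_induction. exists p; auto. }
  unfold induction in Hi.
  intros x. apply Ex_p. revert x. apply Hi.
  rewrite sat_and; [|apply iff_refl|apply iff_refl]. split.
  - unfold inst; rewrite sat_subst.
    replace (fun n => eval v (scons Zero Var n)) with (scons (@zero M) v).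
    + apply Ex_p, H0.
    + apply functional_extensionality; intros [|n]; reflexivity.
  - intros x Hx. rewrite sat_subst.
    replace (fun n => eval (scons x v) (scons (Plus (Var 0) One) (fun n => Var (S n)) n))
      with (scons (x + 1) v).
    + apply Ex_p, Hs, Ex_p, Hx.
    + apply functional_extensionality; intros [|n]; reflexivity.
Qed.

Lemma delta1_comprehension (Q R : M -> M -> Prop) :
  definable (fun v => Q (v 1%nat) (v 0%nat)) ->
  definable (fun v => R (v 1%nat) (v 0%nat)) ->
  (forall x, (exists y, Q x y) <-> (forall y, R x y)) ->
  exists X, forall x, mem x X <-> exists y, Q x y.
Proof.
  intros HQ HR HQR.
  destruct (definable_formulas _ _ _ HQ HR) as (p & q & v & w & Hp & Hq & E). cbn in E.
  assert (Ex_p : forall x, sat (scons x v) w (Ex p) <-> exists y, Q x y).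
  { intros x; apply sat_ex; intros y; symmetry; apply E. }
  assert (All_q : forall x, sat (scons x v) w (All q) <-> forall y, R x y).
  { intros x; apply sat_all; intros y; symmetry; apply E. }
  assert (Hc : sat v w (comprehension (Ex p) (All q))).
  { apply M_RCA0, RCA0_comprehension; [exists p|exists q]; auto. }
  refine (proj1 (sat_imp M v w _ _ _ _ _ _) Hc HQR).
  - apply sat_all; intros x. apply sat_iff; [apply Ex_p|apply All_q].
  - apply sat_exS; intros X. apply sat_all; intros x. apply sat_iff; [reflexivity|].
    unfold shiftS. rewrite sat_subst. apply Ex_p.
Qed.

(* [v 0] is the slot of the existential witness in [sigma1_induction]. *)
Lemma bounded_induction (P : M -> Prop) :
  definable (fun v => P (v 1%nat)) ->
  P 0 -> (forall x, P x -> P (x + 1)) -> forall x, P x.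
Proof.
  intros HP H0 Hs x.
  destruct (sigma1_induction (fun x _ => P x) HP) with (x := x) as [_ H]; auto.
  - exists 0; exact H0.
  - intros y [_ H]; exists 0; auto.
Qed.

Lemma bounded_comprehension (P : M -> Prop) :
  definable (fun v => P (v 1%nat)) -> exists X, forall x, mem x X <-> P x.
Proof.
  intros HP.
  destruct (delta1_comprehension (fun x _ => P x) (fun x _ => P x) HP HP) as [X HX].
  - intros x; split; [intros [_ H]; auto|intros H; exists 0; apply (H 0)].
  - exists X; intros x; rewrite HX. split; [intros [_ H]; exact H|intros H; exists 0; exact H].
Qed.

Ltac induct :=
  match goal with
  | |- forall x, @?P x => apply (bounded_induction P); [try (definability X0)| |]
  end.

Lemma add_zero_l (x : M) : 0 + x = x.
Proof.
  revert x; induct; [apply add_zero_r|]. intros x H. rewrite add_succ_r, H. reflexivity.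
Qed.

Lemma add_succ_l (x y : M) : (x + 1) + y = (x + y) + 1.
Proof.
  revert y; induct; [rewrite !add_zero_r; reflexivity|].
  intros y H. rewrite !add_succ_r, H. reflexivity.
Qed.

Lemma add_comm (x y : M) : x + y = y + x.
Proof.
  revert y; induct; [rewrite add_zero_r, add_zero_l; reflexivity|].
  intros y H. rewrite add_succ_r, add_succ_l, H. reflexivity.
Qed.

Lemma add_assoc (x y z : M) : x + (y + z) = (x + y) + z.
Proof.
  revert z; induct; [rewrite !add_zero_r; reflexivity|].
  intros z H. rewrite !add_succ_r, H. reflexivity.
Qed.

Lemma mul_zero_l (x : M) : 0 * x = 0.
Proof.
  revert x; induct; [apply mul_zero_r|].
  intros x H. rewrite mul_succ_r, H, add_zero_r. reflexivity.
Qed.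

Lemma mul_succ_l (x y : M) : (x + 1) * y = x * y + y.
Proof.
  revert y; induct; [rewrite !mul_zero_r, add_zero_r; reflexivity|].
  intros y H. rewrite !mul_succ_r, H, !add_succ_r. f_equal.
  rewrite <- !add_assoc. f_equal. apply add_comm.
Qed.

Lemma mul_comm (x y : M) : x * y = y * x.
Proof.
  revert y; induct; [rewrite mul_zero_r, mul_zero_l; reflexivity|].
  intros y H. rewrite mul_succ_r, mul_succ_l, H. reflexivity.
Qed.

Lemma mul_add_l (x y z : M) : (x + y) * z = x * z + y * z.
Proof.
  revert y; induct; [rewrite add_zero_r, mul_zero_l, add_zero_r; reflexivity|].
  intros y H. rewrite add_succ_r, !mul_succ_l, H, add_assoc. reflexivity.
Qed.

Lemma mul_assoc (x y z : M) : x * (y * z) = (x * y) * z.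
Proof.
  revert x; induct; [rewrite !mul_zero_l; reflexivity|].
  intros x H. rewrite !mul_succ_l, mul_add_l, H. reflexivity.
Qed.

Lemma mul_one_l (x : M) : 1 * x = x.
Proof.
  rewrite <- (add_zero_l 1), mul_succ_l, mul_zero_l. apply add_zero_l.
Qed.

Lemma model_semiring : semi_ring_theory (@zero M) one add mul eq.
Proof.
  constructor; auto using add_zero_l, add_comm, add_assoc, mul_one_l, mul_zero_l,
    mul_comm, mul_assoc, mul_add_l.
Qed.

Add Ring model_ring : model_semiring.

Lemma lt_self_succ (x : M) : x < x + 1.
Proof. apply lt_succ; right; reflexivity. Qed.

Lemma lt_trans (x y z : M) : x < y -> y < z -> x < z.
Proof.
  intros Hxy; revert z; induct; [intros H; destruct (not_lt_zero _ H)|].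
  intros z IH [H| ->]%lt_succ; apply lt_succ; auto.
Qed.

Lemma zero_le (x : M) : 0 <= x.
Proof.
  revert x; induct; [right; reflexivity|].
  intros x H; left; apply lt_succ, H.
Qed.

Lemma lt_irrefl (x : M) : ~ x < x.
Proof.
  revert x; induct; [apply not_lt_zero|].
  intros x IH [H|H]%lt_succ; apply IH.
  - apply lt_trans with (x + 1); auto using lt_self_succ.
  - rewrite <- H at 2. apply lt_self_succ.
Qed.

Lemma lt_exists (x y : M) : x < y <-> exists z, x + z + 1 = y.
Proof.
  split.
  - revert y.
    (* With the witness pulled in front of the implication, the induction formula is Sigma_1. *)
    enough (forall y, exists z, x < y -> x + z + 1 = y) as E
      by (intros y H; destruct (E y); eauto).
    apply sigma1_induction; [definability X0|exists 0; intros H; destruct (not_lt_zero _ H)|].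
    intros y [z Hz]. destruct (classic (x < y)) as [H|H].
    + exists (z + 1). intros _. rewrite <- (Hz H). ring.
    + exists 0. intros [?| ->]%lt_succ; [contradiction|ring].
  - intros [z <-]. revert z; induct.
    + rewrite add_zero_r. apply lt_self_succ.
    + intros z H. rewrite add_assoc. apply lt_succ; auto.
Qed.

Lemma le_exists (x y : M) : x <= y <-> exists z, x + z = y.
Proof.
  split.
  - intros [H| ->]; [|exists 0; ring].
    apply lt_exists in H as [z <-]. exists (z + 1); ring.
  - intros [z <-]. destruct (zero_le z) as [H| <-]; [|right; ring].
    left. apply lt_exists in H as [u <-]. apply lt_exists. exists u; ring.
Qed.

Lemma lt_succ_le (x y : M) : x < y + 1 <-> x <= y.
Proof. apply lt_succ. Qed.

Lemma le_succ_lt (x y : M) : x + 1 <= y <-> x < y.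
Proof.
  rewrite le_exists, lt_exists.
  split; intros [z <-]; exists z; ring.
Qed.

Lemma lt_or_le (x y : M) : x < y \/ y <= x.
Proof.
  revert x; induct.
  - destruct (zero_le y) as [H| <-]; [left; exact H|right; right; reflexivity].
  - intros x [H|H].
    + apply le_succ_lt in H as [H| <-]; [left; exact H|right; right; reflexivity].
    + right; left; apply lt_succ_le, H.
Qed.

Lemma le_refl (x : M) : x <= x.
Proof. right; reflexivity. Qed.

Lemma lt_le (x y : M) : x < y -> x <= y.
Proof. left; assumption. Qed.

Lemma lt_le_trans (x y z : M) : x < y -> y <= z -> x < z.
Proof. intros H [H'| <-]; eauto using lt_trans. Qed.

Lemma le_lt_trans (x y z : M) : x <= y -> y < z -> x < z.
Proof. intros [H'| ->] H; eauto using lt_trans. Qed.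

Lemma le_trans (x y z : M) : x <= y -> y <= z -> x <= z.
Proof. intros H [H'| <-]; [left; eapply le_lt_trans; eauto|exact H]. Qed.

Lemma le_not_lt (x y : M) : x <= y -> ~ y < x.
Proof. intros H H'. apply (lt_irrefl x). eapply le_lt_trans; eauto. Qed.

Lemma le_antisym (x y : M) : x <= y -> y <= x -> x = y.
Proof. intros [H|H] H'; [destruct (le_not_lt _ _ H' H)|exact H]. Qed.

Lemma add_cancel_r (x y z : M) : x + z = y + z -> x = y.
Proof.
  revert z; induct; [rewrite !add_zero_r; auto|].
  intros z IH H. apply IH, succ_inj. rewrite <- !add_assoc. exact H.
Qed.

(** A substitute for subtraction: the equation says that [B - A] equals [D - C]. A combination of
    known inequalities is passed as the first premise, and [ring] checks the second. *)
Lemma le_by (C D A B : M) : C <= D -> A + D = B + C -> A <= B.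
Proof.
  intros [z <-]%le_exists H. apply le_exists; exists z.
  apply (add_cancel_r _ _ C). rewrite <- H; ring.
Qed.

Lemma lt_by (C D A B : M) : C < D -> A + D = B + C -> A < B.
Proof.
  intros [z <-]%lt_exists H. apply lt_exists; exists z.
  apply (add_cancel_r _ _ C). rewrite <- H; ring.
Qed.

Lemma add_le (x y x' y' : M) : x <= y -> x' <= y' -> x + x' <= y + y'.
Proof. rewrite !le_exists. intros [a <-] [b <-]. exists (a + b); ring. Qed.

Lemma add_lt_le (x y x' y' : M) : x < y -> x' <= y' -> x + x' < y + y'.
Proof. rewrite lt_exists, le_exists, lt_exists. intros [a <-] [b <-]. exists (a + b); ring. Qed.

Lemma mul_le (x y z : M) : x <= y -> x * z <= y * z.
Proof. rewrite !le_exists. intros [a <-]. exists (a * z); ring. Qed.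

Lemma mul_lt (x y z : M) : x < y -> 0 < z -> x * z < y * z.
Proof.
  rewrite !lt_exists. intros [a <-] [b <-]. exists (a * b + a + b); ring.
Qed.

Lemma mul_pos (x y : M) : 0 < x -> 0 < y -> 0 < x * y.
Proof. rewrite !lt_exists. intros [a <-] [b <-]. exists (a * b + a + b); ring. Qed.

Lemma mul_le_cancel (x y z : M) : 0 < z -> x * z <= y * z -> x <= y.
Proof.
  intros Hz H. destruct (lt_or_le y x) as [H'|]; [|assumption].
  destruct (le_not_lt _ _ H). apply mul_lt; assumption.
Qed.

Lemma mul_lt_cancel (x y z : M) : x * z < y * z -> x < y.
Proof.
  intros H. destruct (lt_or_le x y) as [|H']; [assumption|].
  destruct (le_not_lt _ _ (mul_le _ _ z H') H).
Qed.

Lemma zero_lt_one : @zero M < 1.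
Proof. apply lt_exists; exists 0; ring. Qed.

(** If there were no least element, bounded induction on [x] would show that nothing below [x]
    satisfies [P]; the bounded quantifier keeps this formula bounded. *)
Lemma least_element (P : M -> Prop) :
  definable (fun v => P (v 0%nat)) ->
  forall x, P x -> exists y, P y /\ forall z, P z -> y <= z.
Proof.
  intros HP x Hx. apply NNPP; intros Hn.
  assert (H : forall x z, z < x -> ~ P z).
  { apply (bounded_induction (fun x => forall z, z < x -> ~ P z)).
    - apply (definable_ball _ (fun v => v 1%nat) (fun _ z => ~ P z)).
      + apply definable_var.
      + apply (definable_not _ X0 (fun v => P (v 0%nat))), HP.
    - intros z Hz. destruct (not_lt_zero _ Hz).
    - intros y IH z [Hz| ->]%lt_succ; [exact (IH z Hz)|].
      intros Py; apply Hn; exists y; split; [exact Py|].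
      intros z Pz. destruct (lt_or_le z y) as [Hz|]; [|assumption].
      destruct (IH z Hz Pz). }
  exact (H (x + 1) x (lt_self_succ x) Hx).
Qed.

(** * Codes *)

Lemma add_cancel_l (x y z : M) : z + x = z + y -> x = y.
Proof. rewrite !(add_comm z). apply add_cancel_r. Qed.

Lemma le_add_l (x y : M) : x <= x + y.
Proof. apply le_exists; exists y; reflexivity. Qed.

Lemma le_add_r (x y : M) : y <= x + y.
Proof. apply le_exists; exists x; apply add_comm. Qed.

Lemma le_square (x : M) : x <= x * x.
Proof.
  destruct (zero_le x) as [H| <-]; [|right; ring].
  apply lt_exists in H as [y <-]. apply le_exists. exists (y * y + y); ring.
Qed.

Lemma mul_mono (x y x' y' : M) : x <= x' -> y <= y' -> x * y <= x' * y'.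
Proof.
  rewrite !le_exists. intros [a <-] [b <-]. exists (x * b + a * y + a * b); ring.
Qed.

Lemma mpair_mono (i j i' j' : M) : i <= i' -> j <= j' -> mpair i j <= mpair i' j'.
Proof. intros. unfold mpair. auto using add_le, mul_mono. Qed.

Lemma mpair_le_l (i j : M) : i <= mpair i j.
Proof. apply le_add_r. Qed.

Lemma mpair_le_r (i j : M) : j <= mpair i j.
Proof.
  apply le_trans with (i + j); [apply le_add_r|].
  apply le_trans with ((i + j) * (i + j)); [apply le_square|apply le_add_l].
Qed.

(* [mpair i j] lies between the squares of [i + j] and [i + j + 1]. *)
Lemma mpair_lt (i j i' j' : M) : i + j < i' + j' -> mpair i j < mpair i' j'.
Proof.
  intros H. apply lt_le_trans with ((i + j + 1) * (i + j + 1)).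
  - apply lt_exists. exists (i + j + j). unfold mpair. ring.
  - apply le_succ_lt in H.
    apply le_trans with ((i' + j') * (i' + j')); [apply mul_mono; exact H|apply le_add_l].
Qed.

Lemma mpair_inj (i j i' j' : M) : mpair i j = mpair i' j' -> i = i' /\ j = j'.
Proof.
  intros H.
  assert (E : i + j = i' + j').
  { apply le_antisym.
    - destruct (lt_or_le (i' + j') (i + j)) as [Hl|Hl]; [|exact Hl].
      apply mpair_lt in Hl. rewrite H in Hl. destruct (lt_irrefl _ Hl).
    - destruct (lt_or_le (i + j) (i' + j')) as [Hl|Hl]; [|exact Hl].
      apply mpair_lt in Hl. rewrite H in Hl. destruct (lt_irrefl _ Hl). }
  unfold mpair in H. rewrite E in H.
  assert (Ei : i = i').
  { exact (add_cancel_l _ _ _ H). }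
  split; [exact Ei|]. subst i'. exact (add_cancel_l _ _ _ E).
Qed.

Lemma mtriple_inj (a b c a' b' c' : M) :
  mtriple a b c = mtriple a' b' c' -> a = a' /\ b = b' /\ c = c'.
Proof.
  intros [H ->]%mpair_inj. apply mpair_inj in H as [-> ->]. auto.
Qed.

Lemma mtriple_mono (a b c a' b' c' : M) :
  a <= a' -> b <= b' -> c <= c' -> mtriple a b c <= mtriple a' b' c'.
Proof. intros. unfold mtriple. auto using mpair_mono. Qed.

(** Since a code dominates its components, quantifiers over components can be bounded by the code
    plus 1, which is how decoding stays a bounded formula. *)
Lemma mtriple_le (a b c : M) :
  a <= mtriple a b c /\ b <= mtriple a b c /\ c <= mtriple a b c.
Proof.
  split; [|split; [|apply mpair_le_r]];
    (eapply le_trans; [|apply mpair_le_l]); [apply mpair_le_l|apply mpair_le_r].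
Qed.

(** * Rationals *)

(** This definition and the other semantic counterparts of the formulas copy them connective by
    connective, including conjunctive premises, so that [sat_mirror] can match the two sides. *)
Definition mFrac (q a b c : M) : Prop := q = mtriple a b c /\ 0 < c.

Definition mRat (q : M) : Prop :=
  exists a b c, mFrac q a b c /\
    forall a' b' c', 0 < c' /\ a * c' + b' * c = a' * c + b * c' ->
      q <= mtriple a' b' c'.

Definition mRatPos (q : M) : Prop := exists a b c, mFrac q a b c /\ b < a.

Definition mLtAdd (p q r : M) : Prop :=
  exists a b c a' b' c' a'' b'' c'',
    mFrac p a b c /\ mFrac q a' b' c' /\ mFrac r a'' b'' c'' /\
    a * c' * c'' + b' * c * c'' + b'' * c * c'
    < b * c' * c'' + a' * c * c'' + a'' * c * c'.

Definition mLeAdd (p q r : M) : Prop :=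
  exists a b c a' b' c' a'' b'' c'',
    mFrac p a b c /\ mFrac q a' b' c' /\ mFrac r a'' b'' c'' /\
    a * c' * c'' + b' * c * c'' + b'' * c * c'
    <= b * c' * c'' + a' * c * c'' + a'' * c * c'.

Lemma mFrac_unique q a b c a' b' c' :
  mFrac q a b c -> mFrac q a' b' c' -> a' = a /\ b' = b /\ c' = c.
Proof. intros [-> _] [H _]. apply mtriple_inj in H as (-> & -> & ->). auto. Qed.

Ltac frac_unify :=
  repeat match goal with
  | H : mFrac ?q ?a ?b ?c, H' : mFrac ?q ?a' ?b' ?c' |- _ =>
      destruct (mFrac_unique _ _ _ _ _ _ _ H H') as (? & ? & ?); subst a' b' c'; clear H'
  end.

Lemma mRat_frac q : mRat q -> exists a b c, mFrac q a b c.
Proof. intros (a & b & c & H & _); eauto. Qed.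

Lemma one_le_pos (c : M) : 0 < c -> 1 <= c.
Proof. intros H. apply le_succ_lt in H. rewrite add_zero_l in H. exact H. Qed.

Lemma mFrac_nat (j : M) : mFrac (mtriple j 0 1) j 0 1.
Proof. split; [reflexivity|apply zero_lt_one]. Qed.

(** A fraction of value [j] satisfies [a = j * c + b] with [1 <= c], so each of its components is at
    least the corresponding one of [j, 0, 1], and the code is monotone. *)
Lemma mRat_nat (j : M) : mRat (mtriple j 0 1).
Proof.
  exists j, 0, 1; split; [apply mFrac_nat|].
  intros a b c [Hc E]. apply one_le_pos in Hc.
  apply mtriple_mono; auto using zero_le.
  apply le_trans with (j * c).
  - apply le_exists in Hc as [d <-]. apply le_exists; exists (j * d); ring.
  - apply le_exists; exists b. transitivity (j * c + b * 1); [ring|].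
    rewrite E. ring.
Qed.

Lemma frac_eq_trans (a b c a' b' c' a'' b'' c'' : M) : 0 < c' ->
  a * c' + b' * c = a' * c + b * c' ->
  a' * c'' + b'' * c' = a'' * c' + b' * c'' ->
  a * c'' + b'' * c = a'' * c + b * c''.
Proof.
  intros Hc E E'.
  assert (H : (a * c'' + b'' * c) * c' = (a'' * c + b * c'') * c').
  { apply (add_cancel_r _ _ (b' * c * c'' + a' * c * c'')).
    transitivity ((a * c' + b' * c) * c'' + (a' * c'' + b'' * c') * c); [ring|].
    rewrite E, E'. ring. }
  apply le_antisym; apply (mul_le_cancel _ _ c' Hc); right; congruence.
Qed.

(** The least number principle yields the least code of the given value. Transitivity of equality of
    fractions shows that it is also least among the codes equal to itself. *)
Lemma mRat_of_frac a b c : 0 < c ->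
  exists q a' b' c', mRat q /\ mFrac q a' b' c' /\ a * c' + b' * c = a' * c + b * c'.
Proof.
  intros Hc.
  pose (P q := exists a', a' < q + 1 /\ exists b', b' < q + 1 /\ exists c', c' < q + 1 /\
     (q = mtriple a' b' c' /\ 0 < c' /\ a * c' + b' * c = a' * c + b * c')).
  assert (HP : forall a' b' c', 0 < c' -> a * c' + b' * c = a' * c + b * c' ->
     P (mtriple a' b' c')).
  { intros a' b' c' Hc' E. destruct (mtriple_le a' b' c') as (H1 & H2 & H3).
    exists a'; split; [apply lt_succ_le, H1|].
    exists b'; split; [apply lt_succ_le, H2|].
    exists c'; split; [apply lt_succ_le, H3|auto]. }
  destruct (least_element P) with (x := mtriple a b c) as (q & Pq & Hq).
  - unfold P. definability X0.
  - apply HP; [exact Hc|ring].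
  - destruct Pq as (a' & _ & b' & _ & c' & _ & Eq & Hc' & E).
    exists q, a', b', c'. split; [|split; [split; assumption|exact E]].
    exists a', b', c'; split; [split; assumption|].
    intros a'' b'' c'' [Hc'' E']. apply Hq, HP; [exact Hc''|].
    apply (frac_eq_trans _ _ _ a' b' c'); assumption.
Qed.

(* The quantifiers are bounded in order to make [rle] definable. *)
Definition rle (p q : M) : Prop :=
  exists a, a < p + 1 /\ exists b, b < p + 1 /\ exists c, c < p + 1 /\
  exists a', a' < q + 1 /\ exists b', b' < q + 1 /\ exists c', c' < q + 1 /\
    ((p = mtriple a b c /\ 0 < c) /\ (q = mtriple a' b' c' /\ 0 < c') /\
     a * c' + b' * c <= a' * c + b * c').

Lemma rle_definable : definable (fun v => rle (v 1%nat) (v 0%nat)).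
Proof. unfold rle. definability X0. Qed.

Lemma rle_frac p q a b c a' b' c' : mFrac p a b c -> mFrac q a' b' c' ->
  (rle p q <-> a * c' + b' * c <= a' * c + b * c').
Proof.
  intros Hp Hq. split.
  - intros (? & _ & ? & _ & ? & _ & ? & _ & ? & _ & ? & _ & Hp' & Hq' & H).
    fold (mFrac p x x0 x1) in Hp'. fold (mFrac q x2 x3 x4) in Hq'.
    frac_unify. exact H.
  - intros H. pose proof Hp as [Ep _]. pose proof Hq as [Eq _].
    pose proof (mtriple_le a b c) as (H1 & H2 & H3). rewrite <- Ep in H1, H2, H3.
    pose proof (mtriple_le a' b' c') as (H4 & H5 & H6). rewrite <- Eq in H4, H5, H6.
    exists a; split; [apply lt_succ_le, H1|]. exists b; split; [apply lt_succ_le, H2|].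
    exists c; split; [apply lt_succ_le, H3|]. exists a'; split; [apply lt_succ_le, H4|].
    exists b'; split; [apply lt_succ_le, H5|]. exists c'; split; [apply lt_succ_le, H6|].
    auto.
Qed.

Lemma rle_total p q : mRat p -> mRat q -> rle p q \/ rle q p.
Proof.
  intros (a & b & c & Hp)%mRat_frac (a' & b' & c' & Hq)%mRat_frac.
  rewrite (rle_frac _ _ _ _ _ _ _ _ Hp Hq), (rle_frac _ _ _ _ _ _ _ _ Hq Hp).
  destruct (lt_or_le (a * c' + b' * c) (a' * c + b * c')) as [H|H]; [left; left; exact H|right].
  exact H.
Qed.

Lemma rle_trans p q r : mRat p -> mRat q -> mRat r -> rle p q -> rle q r -> rle p r.
Proof.
  intros (a & b & c & Hp)%mRat_frac (a' & b' & c' & Hq)%mRat_frac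
    (a'' & b'' & c'' & Hr)%mRat_frac.
  rewrite (rle_frac _ _ _ _ _ _ _ _ Hp Hq), (rle_frac _ _ _ _ _ _ _ _ Hq Hr),
    (rle_frac _ _ _ _ _ _ _ _ Hp Hr).
  intros H1 H2. apply (mul_le_cancel _ _ c'); [apply Hq|].
  apply (le_by _ _ _ _ (add_le _ _ _ _ (mul_le _ _ c'' H1) (mul_le _ _ c H2))). ring.
Qed.

(** Doubling the denominator halves the fraction, and the result is put into least form. The final
    inequality says, without subtraction or division, that twice [e'] is at most [e]. *)
Lemma half_eps e : mRatPos e ->
  exists e', mRat e' /\ mRatPos e' /\
    exists a b c a' b' c', mFrac e a b c /\ mFrac e' a' b' c' /\
      a' * (c + c) + b * c' <= a * c' + b' * (c + c).
Proof.
  intros (a & b & c & He & Hab).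
  assert (Hc : 0 < c) by apply He.
  destruct (mRat_of_frac a b (c + c)) as (q & a' & b' & c' & Hq & Fq & E).
  { apply lt_le_trans with c; [exact Hc|apply le_add_l]. }
  exists q; split; [exact Hq|split].
  - exists a', b', c'; split; [exact Fq|].
    apply (mul_lt_cancel _ _ (c + c)).
    apply (lt_by _ _ _ _ (mul_lt _ _ c' Hab (proj2 Fq))).
    transitivity (a * c' + b' * (c + c)); [ring|]. rewrite E. ring.
  - exists a, b, c, a', b', c'; repeat split; try apply He; try apply Fq.
    right. symmetry. exact E.
Qed.

Lemma mLtAdd_frac p q r a b c a' b' c' a'' b'' c'' :
  mFrac p a b c -> mFrac q a' b' c' -> mFrac r a'' b'' c'' -> mLtAdd p q r ->
  a * c' * c'' + b' * c * c'' + b'' * c * c'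
  < b * c' * c'' + a' * c * c'' + a'' * c * c'.
Proof.
  intros Hp Hq Hr (? & ? & ? & ? & ? & ? & ? & ? & ? & Hp' & Hq' & Hr' & H).
  frac_unify. exact H.
Qed.

Lemma mLeAdd_frac p q r a b c a' b' c' a'' b'' c'' :
  mFrac p a b c -> mFrac q a' b' c' -> mFrac r a'' b'' c'' -> mLeAdd p q r ->
  a * c' * c'' + b' * c * c'' + b'' * c * c'
  <= b * c' * c'' + a' * c * c'' + a'' * c * c'.
Proof.
  intros Hp Hq Hr (? & ? & ? & ? & ? & ? & ? & ? & ? & Hp' & Hq' & Hr' & H).
  frac_unify. exact H.
Qed.

Lemma three_eps p p' q q' e e' :
  mRat p -> mRat q ->
  (exists a b c a' b' c', mFrac e a b c /\ mFrac e' a' b' c' /\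
      a' * (c + c) + b * c' <= a * c' + b' * (c + c)) ->
  mLtAdd p p' e' -> rle p' q' -> mLtAdd q' q e' -> mLeAdd p q e.
Proof.
  intros (a1 & b1 & c1 & Hp)%mRat_frac (f1 & g1 & d1 & Hq)%mRat_frac
    (a & b & c & a' & b' & c' & He & He' & E) H1 H2 H3.
  assert (Fp' : exists a2 b2 c2, mFrac p' a2 b2 c2).
  { destruct H1 as (? & ? & ? & ? & ? & ? & ? & ? & ? & _ & ? & _); eauto. }
  assert (Fq' : exists f2 g2 d2, mFrac q' f2 g2 d2).
  { destruct H3 as (? & ? & ? & ? & ? & ? & ? & ? & ? & ? & _); eauto. }
  destruct Fp' as (a2 & b2 & c2 & Hp'), Fq' as (f2 & g2 & d2 & Hq').
  apply (mLtAdd_frac _ _ _ _ _ _ _ _ _ _ _ _ Hp Hp' He') in H1.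
  apply (rle_frac _ _ _ _ _ _ _ _ Hp' Hq') in H2.
  apply (mLtAdd_frac _ _ _ _ _ _ _ _ _ _ _ _ Hq' Hq He') in H3.
  exists a1, b1, c1, f1, g1, d1, a, b, c. split; [exact Hp|split; [exact Hq|split; [exact He|]]].
  (* The goal lacks the denominators of [p'], [q'] and [e']. Each hypothesis is multiplied by the
     denominators it lacks, so that all carry the same product of six; in the sum the terms of [p'],
     [q'] and [e'] cancel. *)
  apply (mul_le_cancel _ _ (c2 * d2 * c' )).
  { apply mul_pos; [apply mul_pos|]; [apply Hp'|apply Hq'|apply He']. }
  apply lt_le in H1, H3.
  pose proof (add_le _ _ _ _
    (add_le _ _ _ _ (mul_le _ _ (d1 * c * d2) H1) (mul_le _ _ (c1 * d1 * c * c') H2))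
    (add_le _ _ _ _ (mul_le _ _ (c1 * c * c2) H3) (mul_le _ _ (c1 * d1 * c2 * d2) E))) as H.
  apply (le_by _ _ _ _ H). ring.
Qed.

(** * Reals *)

Definition mIsFun (F : sets M) (A B : M -> Prop) : Prop :=
  (forall z, mem z F -> exists a b, A a /\ B b /\ z = mpair a b) /\
  (forall a, A a ->
     exists b, mem (mpair a b) F /\ forall b', mem (mpair a b') F -> b' = b).

Definition mIsNat (_ : M) : Prop := True.

Definition mentries (Y : sets M) (i q : M) : Prop := mem (mpair i q) Y.
Definition mrow (X : sets M) (n i q : M) : Prop := mem (mpair (mpair n i) q) X.

Definition mCauchy (x : M -> M -> Prop) : Prop :=
  forall eps, mRat eps /\ mRatPos eps ->
    exists N, forall m n, N <= m /\ N <= n ->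
      forall p q, x m p /\ x n q -> mLtAdd p q eps /\ mLtAdd q p eps.

Definition mRealLe (x y : M -> M -> Prop) : Prop :=
  forall eps, mRat eps /\ mRatPos eps ->
    exists N, forall n, N <= n -> forall p q, x n p /\ y n q -> mLeAdd p q eps.

Definition mIsReal (Y : sets M) : Prop :=
  mIsFun Y mIsNat mRat /\ mCauchy (mentries Y).

Definition mRealFamily (N : M) (X : sets M) : Prop :=
  mIsFun X (fun z => exists n i, n < N /\ z = mpair n i) mRat /\
  forall n, n < N -> mCauchy (mrow X n).

Definition mIPP : Prop :=
  forall N C, mIsFun C mIsNat (fun n => n <= N) ->
    exists n, n <= N /\ forall k, exists i, k < i /\ mem (mpair i n) C.

Definition mFiniteSetsBounded : Prop :=
  forall N X, mRealFamily N X ->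
    exists Y Z, mIsReal Y /\ mIsReal Z /\
      forall n, n < N ->
        mRealLe (mentries Y) (mrow X n) /\ mRealLe (mrow X n) (mentries Z).

Definition mFiniteSetsHaveMax : Prop :=
  forall N X, 0 < N /\ mRealFamily N X ->
    exists m, m < N /\ forall n, n < N -> mRealLe (mrow X n) (mrow X m).

(* Reals need no modulus of convergence, so comparing infinitely many entries
   is enough. *)
Lemma real_le_of_infinitely_often (x y : M -> M -> Prop) :
  (forall i p, x i p -> mRat p) -> (forall i p, y i p -> mRat p) ->
  mCauchy x -> mCauchy y ->
  (forall k, exists i p q, k < i /\ x i p /\ y i q /\ rle p q) -> mRealLe x y.
Proof.
  intros Rx Ry Cx Cy H eps [_ Pe].
  destruct (half_eps eps Pe) as (e & He' & Pe' & E).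
  destruct (Cx e) as [k Hk]; [auto|]. destruct (Cy e) as [l Hl]; [auto|].
  (* A single comparison at an index [j] beyond both Cauchy thresholds reaches every later index, at
     the cost of one half of [eps] for each sequence. *)
  destruct (H (k + l)) as (j & p' & q' & Hj & Hp' & Hq' & Hpq).
  assert (kj : k <= j) by (eapply le_trans; [apply le_add_l|apply lt_le, Hj]).
  assert (lj : l <= j) by (eapply le_trans; [apply le_add_r|apply lt_le, Hj]).
  exists (k + l). intros i Hi p q [Hp Hq].
  assert (ki : k <= i) by (eapply le_trans; [apply le_add_l|exact Hi]).
  assert (li : l <= i) by (eapply le_trans; [apply le_add_r|exact Hi]).
  destruct (Hk i j) with (p := p) (q := p') as [H1 _]; auto.
  destruct (Hl i j) with (p := q) (q := q') as [_ H2]; auto.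
  apply (three_eps p p' q q' eps e); eauto.
Qed.

(** * Rows and columns of a finite family of reals *)

Section Family.

Variables (N : M) (X : sets M).
Hypothesis HX : mRealFamily N X.

Lemma row_rat n i p : mrow X n i p -> mRat p.
Proof.
  intros H. destruct HX as [[H1 _] _]. destruct (H1 _ H) as (a & b & _ & Hb & E).
  apply mpair_inj in E as [_ ->]. exact Hb.
Qed.

Lemma row_total n i : n < N -> exists p, mrow X n i p.
Proof.
  intros Hn. destruct HX as [[_ H] _]. destruct (H (mpair n i)) as (p & Hp & _); eauto.
Qed.

Lemma row_functional n i p q : mrow X n i p -> mrow X n i q -> p = q.
Proof.
  intros Hp Hq. destruct HX as [[H1 H2] _].
  destruct (H1 _ Hp) as (a & b & Ha & _ & E). apply mpair_inj in E as [<- _].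
  destruct (H2 _ Ha) as (r & _ & Hr).
  rewrite (Hr p Hp), (Hr q Hq). reflexivity.
Qed.

(** A bound has to be a set of its own, whereas a row is only a slice of the set coding the
    family. *)
Lemma row_real n : n < N -> exists Y, mIsReal Y /\ mentries Y = mrow X n.
Proof.
  intros Hn.
  destruct (bounded_comprehension (fun z => exists i, i < z + 1 /\ exists q, q < z + 1 /\
    (z = mpair i q /\ mem (mpair (mpair n i) q) X))) as [Y HY]; [definability X0|].
  assert (E : mentries Y = mrow X n).
  { apply functional_extensionality; intros i; apply functional_extensionality; intros q.
    apply propositional_extensionality. unfold mentries, mrow. rewrite HY. split.
    - intros (i' & _ & q' & _ & [-> ->]%mpair_inj & H). exact H.
    - intros H. exists i; split; [apply lt_succ_le, mpair_le_l|].
      exists q; split; [apply lt_succ_le, mpair_le_r|auto]. }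
  exists Y; split; [split|exact E].
  - split.
    + intros z Hz. pose proof (proj1 (HY z) Hz) as (i & _ & q & _ & -> & Hq).
      exists i, q. split; [exact I|split; [exact (row_rat _ _ _ Hq)|reflexivity]].
    + intros i _. destruct (row_total n i Hn) as [q Hq]. exists q.
      change (mentries Y i q /\ forall b, mentries Y i b -> b = q). rewrite E.
      split; [exact Hq|]. intros b Hb. exact (row_functional _ _ _ _ Hb Hq).
  - rewrite E. apply HX, Hn.
Qed.

(* An instance of Sigma_1 collection, by induction on [k]. *)
Lemma column_bound i : exists B, forall n, n < N -> exists p, p < B /\ mrow X n i p.
Proof.
  assert (H : forall k, exists B, forall n, n < k -> n < N -> exists p, p < B /\ mrow X n i p).
  { apply sigma1_induction.
    - unfold mrow. definability X0.
    - exists 0. intros n Hn; destruct (not_lt_zero _ Hn).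
    - intros k [B HB]. destruct (classic (k < N)) as [Hk|Hk].
      + destruct (row_total k i Hk) as [q Hq].
        exists (B + (q + 1)). intros n [Hn| ->]%lt_succ HnN.
        * destruct (HB n Hn HnN) as (p & Hp & Hpr). exists p; split; [|exact Hpr].
          eapply lt_le_trans; [exact Hp|apply le_add_l].
        * exists q; split; [|exact Hq].
          eapply lt_le_trans; [apply lt_self_succ|apply le_add_r].
      + exists B. intros n [Hn| ->]%lt_succ HnN; [auto|contradiction]. }
  destruct (H N) as [B HB]. exists B; auto.
Qed.

(** * Rows that are extremal in infinitely many columns *)

Section Extremum.

(** Kept abstract so that one argument gives maxima, with [rle], and minima, with its converse. *)
Variable R : M -> M -> Prop.
Hypothesis R_definable : definable (fun v => R (v 1%nat) (v 0%nat)).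
Hypothesis R_total : forall p q, mRat p -> mRat q -> R p q \/ R q p.
Hypothesis R_trans :
  forall p q r, mRat p -> mRat q -> mRat r -> R p q -> R q r -> R p r.

Let col_le (i m n : M) : Prop := exists p q, mrow X m i p /\ mrow X n i q /\ R p q.

(** The version of [col_le] with bounded witnesses, hence definable; the two agree as soon as [B]
    bounds the entries of column [i]. *)
Let col_le_below (B i m n : M) : Prop :=
  exists p, p < B /\ exists q, q < B /\ (mrow X m i p /\ mrow X n i q /\ R p q).

Lemma col_le_total i m n : m < N -> n < N -> col_le i m n \/ col_le i n m.
Proof.
  intros Hm Hn. destruct (row_total m i Hm) as [p Hp], (row_total n i Hn) as [q Hq].
  destruct (R_total p q); eauto using row_rat; [left; exists p, q|right; exists q, p]; auto.
Qed.

Lemma col_le_trans i l m n : col_le i l m -> col_le i m n -> col_le i l n.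
Proof.
  intros (p & q & Hp & Hq & Hpq) (q' & r & Hq' & Hr & Hqr).
  rewrite (row_functional _ _ _ _ Hq' Hq) in Hqr.
  exists p, r; split; [exact Hp|split; [exact Hr|]].
  apply (R_trans p q r); eauto using row_rat.
Qed.

Lemma col_le_below_iff B i m n :
  (forall n, n < N -> exists p, p < B /\ mrow X n i p) -> m < N -> n < N ->
  (col_le_below B i m n <-> col_le i m n).
Proof.
  intros HB Hm Hn. split.
  - intros (p & _ & q & _ & H). exists p, q; exact H.
  - intros (p & q & Hp & Hq & Hpq).
    destruct (HB m Hm) as (p' & Bp & Hp'), (HB n Hn) as (q' & Bq & Hq').
    rewrite (row_functional _ _ _ _ Hp Hp') in *.
    rewrite (row_functional _ _ _ _ Hq Hq') in *.
    exists p'; split; [exact Bp|]. exists q'; auto.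
Qed.

(** The clause for [m < n] breaks ties in favor of the first row, which makes the color of [i]
    unique. *)
Let best (i n : M) : Prop :=
  n < N /\ forall m, m < N -> col_le i m n /\ (m < n -> ~ col_le i n m).

Lemma best_exists i : 0 < N -> exists n, best i n.
Proof.
  intros HN. destruct (column_bound i) as [B HB].
  (* Induction over initial segments of [k + 1] rows, which are never empty. The bound [B] is fixed
     beforehand, so the induction formula is bounded. *)
  assert (H : forall k, k + 1 <= N -> exists n, n < k + 1 /\ forall m, m < k + 1 ->
     col_le_below B i m n /\ (m < n -> ~ col_le_below B i n m)).
  { induct.
    - unfold col_le_below, mrow. definability X0.
    - intros _. exists 0; split; [apply lt_self_succ|].
      intros m [Hm|Hm]%lt_succ; [destruct (not_lt_zero _ Hm)|]. rewrite Hm.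
      split; [|intros H0; destruct (not_lt_zero _ H0)].
      apply col_le_below_iff; auto. destruct (col_le_total i 0 0 HN HN); assumption.
    - intros k IH Hk.
      assert (Hk1 : k + 1 < N) by (apply le_succ_lt, Hk).
      destruct (IH (lt_le _ _ Hk1)) as (n & Hn & Hmax).
      assert (HnN : n < N) by eauto using lt_trans.
      (* The new row replaces the old choice only if it is strictly better, so ties stay with the
         earlier row. *)
      destruct (classic (col_le_below B i (k + 1) n)) as [Hc|Hc].
      + exists n; split; [apply lt_succ; auto|].
        intros m [Hm| ->]%lt_succ; [auto|]. split; [exact Hc|].
        intros H. destruct (lt_irrefl n). eauto using lt_trans.
      + exists (k + 1); split; [apply lt_self_succ|].
        assert (Hnk : col_le i n (k + 1)).
        { destruct (col_le_total i n (k + 1) HnN Hk1) as [H|H]; [exact H|].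
          destruct Hc. apply col_le_below_iff; auto. }
        intros m [Hm| ->]%lt_succ.
        * assert (HmN : m < N) by eauto using lt_trans.
          destruct (Hmax m Hm) as [Hmn _]. apply col_le_below_iff in Hmn; auto.
          split; [apply col_le_below_iff; eauto using col_le_trans|].
          intros _ H. apply Hc. apply col_le_below_iff in H; auto.
          apply col_le_below_iff; eauto using col_le_trans.
        * split; [|intros H; destruct (lt_irrefl _ H)].
          apply col_le_below_iff; auto.
          destruct (col_le_total i (k + 1) (k + 1) Hk1 Hk1); assumption. }
  apply lt_exists in HN as [k Hk]. rewrite add_zero_l in Hk.
  destruct (H k) as (n & Hn & Hmax); [right; exact Hk|]. rewrite Hk in *.
  exists n; split; [exact Hn|]. intros m Hm. destruct (Hmax m Hm) as [H1 H2].
  rewrite col_le_below_iff in H1, H2 by auto. auto.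
Qed.

Lemma best_unique i n n' : best i n -> best i n' -> n = n'.
Proof.
  intros [Hn Hb] [Hn' Hb'].
  destruct (lt_or_le n n') as [H|[H|H]]; [exfalso|exfalso|auto].
  - exact (proj2 (Hb' n Hn) H (proj1 (Hb n' Hn'))).
  - exact (proj2 (Hb n' Hn') H (proj1 (Hb' n Hn))).
Qed.

(** Given a bound on the column, being best is a bounded condition. Asking for it with some bound is
    Sigma_1, asking for it with every bound is Pi_1, and the two agree because a bound exists. *)
Lemma best_coloring : exists C, forall z, mem z C <-> exists i n, z = mpair i n /\ best i n.
Proof.
  pose (bnd i B := forall n, n < N -> exists p, p < B /\ mrow X n i p).
  pose (best' B i n := forall m, m < N ->
     col_le_below B i m n /\ (m < n -> ~ col_le_below B i n m)).
  assert (Hbest : forall B i n, bnd i B -> n < N -> (best' B i n <-> best i n)).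
  { intros B i n HB Hn. unfold best', best. split.
    - intros H; split; [exact Hn|]. intros m Hm. specialize (H m Hm).
      rewrite !col_le_below_iff in H by auto. exact H.
    - intros [_ H] m Hm. rewrite !col_le_below_iff by auto. auto. }
  pose (Q z B := exists i, i < z + 1 /\ exists n, n < z + 1 /\
     (z = mpair i n /\ n < N /\ bnd i B /\ best' B i n)).
  pose (S z B := exists i, i < z + 1 /\ exists n, n < z + 1 /\
     (z = mpair i n /\ n < N /\ (bnd i B -> best' B i n))).
  assert (HQ : forall z, (exists B, Q z B) <-> exists i n, z = mpair i n /\ best i n).
  { intros z; split.
    - intros (B & i & _ & n & _ & E & Hn & HB & Hb). exists i, n; split; [exact E|].
      apply (Hbest B); assumption.
    - intros (i & n & E & Hb). destruct (column_bound i) as [B HB].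
      exists B, i; rewrite E; split; [apply lt_succ_le, mpair_le_l|].
      exists n; split; [apply lt_succ_le, mpair_le_r|].
      pose proof (proj1 Hb) as Hn. split; [reflexivity|split; [exact Hn|split; [exact HB|]]].
      apply Hbest; assumption. }
  destruct (delta1_comprehension Q S) as [C HC].
  - unfold Q, bnd, best', col_le_below, mrow. definability X0.
  - unfold S, bnd, best', col_le_below, mrow. definability X0.
  - intros z. rewrite HQ. split.
    + intros (i & n & E & Hb) B. exists i; rewrite E; split; [apply lt_succ_le, mpair_le_l|].
      exists n; split; [apply lt_succ_le, mpair_le_r|].
      pose proof (proj1 Hb) as Hn. split; [reflexivity|split; [exact Hn|]].
      intros HB; apply Hbest; assumption.
    (* The instance at 0 serves to decode [z]; only after [i] is known can a true bound on its
       column be inserted. *)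
    + intros H. destruct (H 0) as (i & _ & n & _ & E & Hn & _).
      destruct (column_bound i) as [B HB].
      destruct (H B) as (i' & _ & n' & _ & E' & _ & Hb).
      rewrite E in E'. apply mpair_inj in E' as [<- <-].
      exists i, n; split; [exact E|]. apply (Hbest B); auto.
  - exists C. intros z; rewrite HC; apply HQ.
Qed.

Lemma extremum_infinitely_often : mIPP -> 0 < N ->
  exists n, n < N /\ forall m, m < N -> forall k, exists i p q,
    k < i /\ mrow X m i p /\ mrow X n i q /\ R p q.
Proof.
  intros Hipp HN. destruct best_coloring as [C HC].
  (* [mIPP] counts its colors up to and including the given number, so the [N] rows require its
     instance at the predecessor of [N]. *)
  apply lt_exists in HN as E. destruct E as [N' EN]. rewrite add_zero_l in EN.
  destruct (Hipp N' C) as (n & Hn & Hinf).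
  - split.
    + intros z Hz. apply HC in Hz as (i & n & -> & Hb). exists i, n.
      split; [exact I|split; [|reflexivity]]. apply lt_succ_le. rewrite EN. apply Hb.
    + intros i _. destruct (best_exists i HN) as [n Hn]. exists n; split.
      * apply HC; eauto.
      * intros n' Hn'. apply HC in Hn' as (i1 & n1 & [<- <-]%mpair_inj & Hb).
        eapply best_unique; eassumption.
  - exists n. split; [rewrite <- EN; apply lt_succ_le, Hn|].
    intros m Hm k. destruct (Hinf k) as (i & Hi & Hc).
    apply HC in Hc as (i1 & n1 & [<- <-]%mpair_inj & _ & Hb).
    destruct (Hb m Hm) as [(p & q & H) _]. exists i, p, q; auto.
Qed.

End Extremum.

(** * Maxima and bounds from the pigeonhole principle *)

Lemma maximum_of_IPP : mIPP -> 0 < N ->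
  exists n, n < N /\ forall m, m < N -> mRealLe (mrow X m) (mrow X n).
Proof.
  intros Hipp HN.
  destruct (extremum_infinitely_often rle) as (n & Hn & H);
    auto using rle_definable, rle_total.
  { intros p q r; apply rle_trans. }
  exists n; split; [exact Hn|]. intros m Hm.
  apply real_le_of_infinitely_often; eauto using row_rat; apply HX; assumption.
Qed.

Lemma minimum_of_IPP : mIPP -> 0 < N ->
  exists n, n < N /\ forall m, m < N -> mRealLe (mrow X n) (mrow X m).
Proof.
  intros Hipp HN.
  destruct (extremum_infinitely_often (fun p q => rle q p)) as (n & Hn & H); auto.
  - apply (definable_rename _ (fun v => rle (v 1%nat) (v 0%nat))
             (fun n => if n =? 0 then 1%nat else 0%nat)), rle_definable.
  - intros; apply rle_total; auto.
  - intros p q r ? ? ? ? ?; apply (rle_trans r q p); auto.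
  - exists n; split; [exact Hn|]. intros m Hm.
    apply real_le_of_infinitely_often; eauto using row_rat; try (apply HX; assumption).
    intros k. destruct (H m Hm k) as (i & p & q & ? & ? & ? & ?). exists i, q, p; auto.
Qed.

End Family.

Lemma max_of_IPP : mIPP -> mFiniteSetsHaveMax.
Proof. intros H N X [HN HX]. apply maximum_of_IPP; assumption. Qed.

Lemma LtAdd_self p e : mRat p -> mRatPos e -> mLtAdd p p e.
Proof.
  intros (a & b & c & Hp)%mRat_frac (a' & b' & c' & He & H).
  exists a, b, c, a, b, c, a', b', c'. repeat split; try apply Hp; try apply He.
  apply (lt_by _ _ _ _ (mul_lt _ _ (c * c) H (mul_pos _ _ (proj2 Hp) (proj2 Hp)))). ring.
Qed.

(** Provides bounds for the empty family, which has no extremal row. *)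
Lemma real_zero : exists Y, mIsReal Y.
Proof.
  destruct (bounded_comprehension (fun z => exists i, i < z + 1 /\ z = mpair i (mtriple 0 0 1)))
    as [Y HY]; [definability X0|].
  assert (E : forall i q, mem (mpair i q) Y <-> q = mtriple 0 0 1).
  { intros i q. rewrite HY. split.
    - intros (? & _ & [_ ->]%mpair_inj). reflexivity.
    - intros ->. exists i; split; [apply lt_succ_le, mpair_le_l|reflexivity]. }
  exists Y; split; [split|].
  - intros z Hz. pose proof (proj1 (HY z) Hz) as (i & _ & ->).
    exists i, (mtriple 0 0 1). split; [exact I|split; [apply mRat_nat|reflexivity]].
  - intros i _. exists (mtriple 0 0 1). split; [apply E; reflexivity|]. intros q; apply E.
  - intros eps [_ He]. exists 0. intros m n _ p q [Hp Hq].
    apply E in Hp as ->. apply E in Hq as ->. auto using LtAdd_self, mRat_nat.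
Qed.

Lemma bounded_of_IPP : mIPP -> mFiniteSetsBounded.
Proof.
  intros Hipp N X HX. destruct (zero_le N) as [HN|HN].
  - destruct (minimum_of_IPP N X HX Hipp HN) as (l & Hl & Hmin).
    destruct (maximum_of_IPP N X HX Hipp HN) as (u & Hu & Hmax).
    destruct (row_real N X HX l Hl) as (Y & HY & EY).
    destruct (row_real N X HX u Hu) as (Z & HZ & EZ).
    exists Y, Z; split; [exact HY|split; [exact HZ|]]. rewrite EY, EZ. auto.
  - destruct real_zero as [Y HY]. exists Y, Y; split; [exact HY|split; [exact HY|]].
    intros n Hn. rewrite <- HN in Hn. destruct (not_lt_zero _ Hn).
Qed.

(** * The pigeonhole principle from upper bounds *)

Section Coloring.

Variables (N : M) (C : sets M).
Hypothesis HC : mIsFun C mIsNat (fun n => n <= N).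

(* [0] is the junk value if no index up to [i] has color [n]. *)
Definition last_index (n i j : M) : Prop :=
  j < i + 1 /\ (mem (mpair j n) C \/ j = 0) /\
  forall j', j' < i + 1 -> j < j' -> ~ mem (mpair j' n) C.

Lemma last_index_exists n i : exists j, last_index n i j.
Proof.
  (* Repeating the bound on [j] in front brings the existence statement into bounded form, as
     bounded induction requires. *)
  enough (H : forall i, exists j, j < i + 1 /\ last_index n i j)
    by (destruct (H i) as (j & _ & Hj); eauto).
  unfold last_index. induct.
  - exists 0. split; [apply lt_self_succ|]. split; [apply lt_self_succ|split; [auto|]].
    intros j [H|H]%lt_succ H' _; [exact (not_lt_zero _ H)|].
    rewrite H in H'. exact (lt_irrefl _ H').
  - intros k (j & Hj & _ & Hc & Hlast).
    destruct (classic (mem (mpair (k + 1) n) C)) as [Hk|Hk].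
    + exists (k + 1). split; [apply lt_self_succ|]. split; [apply lt_self_succ|split; [auto|]].
      intros j' H%lt_succ_le H'. destruct (le_not_lt _ _ H H').
    + assert (Hj' : j < k + 1 + 1) by (apply lt_succ; auto).
      exists j; split; [exact Hj'|split; [exact Hj'|split; [exact Hc|]]].
      intros j' [H| ->]%lt_succ H'; auto.
Qed.

(** Beyond [k] the color no longer occurs, so a larger last index would be an occurrence up to [k]
    that the smaller one missed. This is why the rows are eventually constant. *)
Lemma last_index_unique n k i i' j j' :
  (forall l, k < l -> ~ mem (mpair l n) C) -> k <= i -> k <= i' ->
  last_index n i j -> last_index n i' j' -> j = j'.
Proof.
  intros Hfin.
  assert (H : forall i i' j j', k <= i -> last_index n i j -> last_index n i' j' -> ~ j < j').
  { clear i i' j j'. intros i i' j j' Hi (_ & _ & Hlast) (_ & [Hc| ->] & _) Hlt.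
    - apply (Hlast j'); [|exact Hlt|exact Hc].
      apply lt_succ_le. destruct (lt_or_le k j') as [Hk|Hk]; [destruct (Hfin _ Hk Hc)|].
      eauto using le_trans.
    - exact (not_lt_zero _ Hlt). }
  intros Hi Hi' Hj Hj'.
  destruct (lt_or_le j j') as [Hl|[Hl|Hl]]; [| |auto].
  - destruct (H i i' j j'); assumption.
  - destruct (H i' i j' j); assumption.
Qed.

Lemma last_index_functional n i j j' : last_index n i j -> last_index n i j' -> j = j'.
Proof.
  intros (Hi & H1 & H2) (Hi' & H1' & H2').
  destruct (lt_or_le j j') as [Hl|[Hl|Hl]]; [exfalso|exfalso|auto].
  - destruct H1' as [H| ->]; [exact (H2 j' Hi' Hl H)|exact (not_lt_zero _ Hl)].
  - destruct H1 as [H| ->]; [exact (H2' j Hi Hl H)|exact (not_lt_zero _ Hl)].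
Qed.

(** Bounded comprehension suffices, since the code of an element bounds the row, the position and
    the index. There is one row per color, hence [N + 1] of them. *)
Lemma last_index_family : exists X,
  (forall z, mem z X -> exists n i q, z = mpair (mpair n i) q) /\
  forall n i q,
    mrow X n i q <-> n < N + 1 /\ exists j, q = mtriple j 0 1 /\ last_index n i j.
Proof.
  destruct (bounded_comprehension (fun z =>
    exists n, n < z + 1 /\ exists i, i < z + 1 /\ exists j, j < z + 1 /\
      (z = mpair (mpair n i) (mtriple j 0 1) /\ n < N + 1 /\ last_index n i j)))
    as [X HX]; [unfold last_index; definability X0|].
  exists X. split.
  { intros z Hz. apply HX in Hz as (n & _ & i & _ & j & _ & -> & _). eauto. }
  intros n i q. unfold mrow. rewrite HX. split.
  - intros (n' & _ & i' & _ & j & _ & [E ->]%mpair_inj & Hn & Hj).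
    apply mpair_inj in E as [-> ->]. eauto.
  - intros (Hn & j & -> & Hj).
    exists n; split; [apply lt_succ_le; eapply le_trans; [apply mpair_le_l|apply mpair_le_l]|].
    exists i; split; [apply lt_succ_le; eapply le_trans; [apply mpair_le_r|apply mpair_le_l]|].
    exists j; split; [|auto].
    apply lt_succ_le. eapply le_trans; [apply (proj1 (mtriple_le j 0 1))|apply mpair_le_r].
Qed.

(* If every color is finite, the last indices form a family of eventually
   constant reals, and each bound on it bounds all indices. *)
Lemma infinite_color :
  (forall X, mRealFamily (N + 1) X -> exists z, mCauchy z /\
     (forall i, exists p, z i p) /\ (forall i p, z i p -> mRat p) /\
     forall n, n < N + 1 -> mRealLe (mrow X n) z) ->
  exists n, n <= N /\ forall k, exists i, k < i /\ mem (mpair i n) C.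
Proof.
  intros Hbound. apply NNPP; intros Hn.
  assert (Hfin : forall n, n < N + 1 -> exists k, forall l, k < l -> ~ mem (mpair l n) C).
  { intros n Hle%lt_succ_le. apply NNPP; intros Hk. apply Hn; exists n; split; [exact Hle|].
    intros k. apply NNPP; intros Hi. apply Hk; exists k; intros l Hl Hc. eauto. }
  destruct last_index_family as (X & Hcode & HX).
  destruct (Hbound X) as (z & Cz & Tz & Rz & Hz).
  { split; [split|].
    - intros y Hy. destruct (Hcode y Hy) as (n & i & q & ->).
      destruct (proj1 (HX n i q) Hy) as (Hn' & j & -> & _).
      exists (mpair n i), (mtriple j 0 1). split; [eauto|split; [apply mRat_nat|reflexivity]].
    - intros a (n & i & Hn' & ->). destruct (last_index_exists n i) as [j Hj].
      exists (mtriple j 0 1). split; [apply HX; eauto|].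
      intros b Hb. apply HX in Hb as (_ & j' & -> & Hj').
      f_equal. eapply last_index_functional; eassumption.
    - intros n Hn' eps [_ He]. destruct (Hfin n Hn') as [k Hk]. exists k.
      intros i i' [Hi Hi'] p q [Hp Hq].
      apply HX in Hp as (_ & j & -> & Hj). apply HX in Hq as (_ & j' & -> & Hj').
      rewrite (last_index_unique n k i i' j j') by assumption.
      auto using LtAdd_self, mRat_nat. }
  pose (e := @mtriple M 1 0 1).
  assert (Fe : mFrac e 1 0 1) by apply mFrac_nat.
  assert (He : mRat e /\ mRatPos e).
  { split; [apply mRat_nat|]. exists 1, 0, 1; split; [exact Fe|apply zero_lt_one]. }
  destruct (Cz e He) as [k Hk].
  destruct (Tz k) as [p0 Hp0]. destruct (mRat_frac _ (Rz _ _ Hp0)) as (a & b & c & F0).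
  (* With tolerance 1, late entries of [z] stay below its [k]-th entry plus 1, and late entries of a
     row exceed those of [z] by at most 1. As the [k]-th entry is at most [a], late last indices
     would be below [a + 2]; the color of the index [a + 2] refutes this. *)
  destruct HC as [HC1 HC2]. destruct (HC2 (a + 1 + 1) I) as (n & Hc & _).
  assert (Hn' : n < N + 1).
  { destruct (HC1 _ Hc) as (? & ? & _ & Hle & [_ ->]%mpair_inj). apply lt_succ_le, Hle. }
  destruct (Hz n Hn' e He) as [k' Hk'].
  (* A position beyond both thresholds and beyond the index [a + 2], so that the last index there is
     at least [a + 2]. *)
  pose (i := k + (k' + (a + 1 + 1))).
  assert (Hki : k <= i) by apply le_add_l.
  assert (Hki' : k' <= i) by (eapply le_trans; [apply le_add_l|apply le_add_r]).
  assert (Hai : a + 1 + 1 <= i) by (eapply le_trans; [apply le_add_r|apply le_add_r]).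
  destruct (last_index_exists n i) as [j Hj].
  assert (Haj : a + 1 + 1 <= j).
  { destruct (lt_or_le j (a + 1 + 1)) as [H|H]; [|exact H].
    destruct Hj as (_ & _ & Hlast). destruct (Hlast (a + 1 + 1)); auto. apply lt_succ_le, Hai. }
  destruct (Tz i) as [p Hp]. destruct (mRat_frac _ (Rz _ _ Hp)) as (a' & b' & c' & F).
  assert (H1 : mLeAdd (mtriple j 0 1) p e).
  { apply (Hk' i Hki'); split; [apply HX; eauto|exact Hp]. }
  destruct (Hk i k) with (p := p) (q := p0) as [H2 _]; auto using le_refl.
  apply (mLeAdd_frac _ _ _ _ _ _ _ _ _ _ _ _ (mFrac_nat j) F Fe) in H1.
  apply (mLtAdd_frac _ _ _ _ _ _ _ _ _ _ _ _ F F0 Fe) in H2.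
  assert (H3 : j * c + b < a + c + c).
  { apply (mul_lt_cancel _ _ c').
    apply (lt_by _ _ _ _ (add_lt_le _ _ _ _ H2 (mul_le _ _ c H1))). ring. }
  destruct F0 as [_ Hc0]. apply one_le_pos in Hc0.
  apply (le_not_lt (a + c + c) (j * c + b)); [|exact H3].
  apply le_trans with (j * c); [|apply le_add_l].
  apply le_trans with ((a + 1 + 1) * c); [|apply mul_le, Haj].
  apply le_exists in Hc0 as [d <-]. apply le_exists. exists (a * d). ring.
Qed.

End Coloring.

(** The greatest row is itself the upper bound. For this reason [infinite_color] accepts a bound
    given as a relation rather than a set. *)
Lemma IPP_of_max : mFiniteSetsHaveMax -> mIPP.
Proof.
  intros H N C HC. apply (infinite_color N C HC). intros X HX.
  destruct (H (N + 1) X) as (m & Hm & Hmax).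
  { split; [apply lt_succ_le, zero_le|exact HX]. }
  exists (mrow X m). repeat split; eauto using row_total, row_rat. apply HX, Hm.
Qed.

Lemma IPP_of_bounded : mFiniteSetsBounded -> mIPP.
Proof.
  intros H N C HC. apply (infinite_color N C HC). intros X HX.
  destruct (H (N + 1) X HX) as (Y & Z & _ & [[HZ1 HZ2] HZ] & Hle).
  exists (mentries Z). split; [|split; [|split]].
  - exact HZ.
  - intros i. destruct (HZ2 i I) as (p & Hp & _). exists p; exact Hp.
  - intros i p Hp. destruct (HZ1 _ Hp) as (? & ? & _ & Hr & [_ ->]%mpair_inj). exact Hr.
  - intros n Hn. apply Hle, Hn.
Qed.

(** * Truth of the three sentences in a model *)

Ltac mirror :=
  unfold mIPP, mFiniteSetsBounded, mFiniteSetsHaveMax, mIsReal, mRealFamily, mRealLe,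
    mCauchy, mLeAdd, mLtAdd, mRatPos, mRat, mFrac, mIsFun, mIsNat, mentries, mrow, le;
  cbv beta; sat_mirror.

Lemma sat_IPP v w : @sat M v w IPP <-> mIPP.
Proof. mirror. Qed.

Lemma sat_FiniteSetsBounded v w : @sat M v w FiniteSetsBounded <-> mFiniteSetsBounded.
Proof. mirror. Qed.

Lemma sat_FiniteSetsHaveMax v w : @sat M v w FiniteSetsHaveMax <-> mFiniteSetsHaveMax.
Proof. mirror. Qed.

Lemma statements_equivalent p q v w :
  In p [IPP; FiniteSetsBounded; FiniteSetsHaveMax] ->
  In q [IPP; FiniteSetsBounded; FiniteSetsHaveMax] ->
  @sat M v w p -> @sat M v w q.
Proof.
  assert (H : forall p, In p [IPP; FiniteSetsBounded; FiniteSetsHaveMax] ->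
                        (@sat M v w p <-> mIPP)).
  { intros r [<-|[<-|[<-|[]]]].
    - apply sat_IPP.
    - rewrite sat_FiniteSetsBounded. split; [apply IPP_of_bounded|apply bounded_of_IPP].
    - rewrite sat_FiniteSetsHaveMax. split; [apply IPP_of_max|apply max_of_IPP]. }
  intros Hp Hq. rewrite (H p Hp), (H q Hq). auto.
Qed.

End Models.

Theorem lemma2p13 :
  forall p q : form,
    In p [IPP; FiniteSetsBounded; FiniteSetsHaveMax] ->
    In q [IPP; FiniteSetsBounded; FiniteSetsHaveMax] ->
    prv RCA0 [] (Iff p q).
Proof.
  intros p q Hp Hq. apply (completeness RCA0 RCA0_subst). intros M HM v w.
  apply (sat_iff M v w p q _ _ (iff_refl _) (iff_refl _)).
  split; apply (statements_equivalent M HM (w 0)); assumption.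
Qed.
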